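(* Let $A$ be either the disk algebra $\mathcal{A}$ or the algebra $H^\infty$. Let $\phi$ be a non-constant analytic self-map of the open unit disk $\mathbb{D}$ inducing a composition operator $C_\phi f=f\circ\phi$ on $A$ (i.e. $C_\phi$ maps $A$ into $A$), and suppose that $\phi$ is not an elliptic automorphism of $\mathbb{D}$. Then $C_\phi$ is not recurrent on $A$.
   Context: $\mathcal{A}$ is the Banach algebra of functions analytic on $\mathbb{D}$ and continuous on $\overline{\mathbb{D}}$, and $H^\infty$ is the Banach algebra of bounded analytic functions on $\mathbb{D}$, both with the supremum norm. An elliptic automorphism of $\mathbb{D}$ is a conformal automorphism of $\mathbb{D}$ having a fixed point in $\mathbb{D}$ (the identity map is included here). A bounded operator $T$ on a Banach space $X$ is recurrent if for every nonempty open set $U\subset X$ there is a positive integer $k$ with $U\cap T^{-k}(U)\neq\emptyset$ (equivalently, the set of vectors $x$ for which there is a strictly increasing sequence of positive integers $(k_n)$ with $T^{k_n}x\to x$ is dense in $X$). *)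

(* Defs.v *)
From Stdlib Require Import Reals Lra Lia.
From Stdlib Require Import FunctionalExtensionality ProofIrrelevance ClassicalEpsilon.
From Coquelicot Require Import Coquelicot.

Open Scope R_scope.

Definition disk : Type := {z : C | Cmod z < 1}.

Definition disk_val (z : disk) : C := proj1_sig z.
Coercion disk_val : disk >-> C.

Lemma disk_inhabited : Cmod 0%C < 1.
Proof. rewrite Cmod_0; lra. Qed.

Definition disk0 : disk := exist (fun z : C => Cmod z < 1) (RtoC 0) disk_inhabited.

Definition analytic (f : disk -> C) : Prop :=
  forall z0 : disk, exists (a : nat -> C) (r : R), 0 < r /\
    forall z : disk, Cmod (z - z0) < r -> is_pseries a (z - z0)%C (f z).

Definition bounded (f : disk -> C) : Prop :=
  exists M : R, forall z : disk, Cmod (f z) <= M.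

Definition extends_continuously (f : disk -> C) : Prop :=
  exists F : C -> C,
    continuous_on (fun z : C => Cmod z <= 1) F /\ forall z : disk, F z = f z.

Definition sup_norm (f : disk -> C) : R :=
  real (Lub_Rbar (fun r : R => exists z : disk, r = Cmod (f z))).

Record function_space : Type := FunctionSpace {
  fs_mem :> (disk -> C) -> Prop;
  fs_zero : fs_mem (fun _ => 0%C);
  fs_plus : forall f g, fs_mem f -> fs_mem g -> fs_mem (fun z => (f z + g z)%C);
  fs_scal : forall (c : C) f, fs_mem f -> fs_mem (fun z => (c * f z)%C);
  fs_bounded : forall f, fs_mem f -> bounded f
}.

Lemma analytic_zero : analytic (fun _ => 0%C).
Proof.
intros z0; exists (fun _ => 0%C), 1; split; [lra|]; intros z _.
unfold is_pseries.
apply (is_series_ext (fun _ => (zero : C))).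
  intros n; symmetry; exact (scal_zero_r (V := C_NormedModule) _).
unfold is_series.
apply filterlim_ext with (fun _ : nat => (zero : C)).
  intros n; induction n as [|n IH].
    now rewrite sum_O.
  now rewrite sum_Sn, <- IH, plus_zero_l.
apply filterlim_const.
Qed.

Lemma analytic_plus f g :
  analytic f -> analytic g -> analytic (fun z => (f z + g z)%C).
Proof.
intros Hf Hg z0.
destruct (Hf z0) as [a [r [Hr Ha]]]; destruct (Hg z0) as [b [s [Hs Hb]]].
exists (fun n => (a n + b n)%C), (Rmin r s); split.
  now apply Rmin_glb_lt.
intros z Hz.
apply (is_pseries_plus a b).
  apply Ha, Rlt_le_trans with (1 := Hz), Rmin_l.
apply Hb, Rlt_le_trans with (1 := Hz), Rmin_r.
Qed.

Lemma analytic_scal c f : analytic f -> analytic (fun z => (c * f z)%C).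
Proof.
intros Hf z0; destruct (Hf z0) as [a [r [Hr Ha]]].
exists (fun n => (c * a n)%C), r; split; [exact Hr|]; intros z Hz.
apply (is_pseries_scal c a).
  apply Cmult_comm.
now apply Ha.
Qed.

Lemma bounded_zero : bounded (fun _ => 0%C).
Proof. exists 0; intros _; rewrite Cmod_0; lra. Qed.

Lemma bounded_plus f g :
  bounded f -> bounded g -> bounded (fun z => (f z + g z)%C).
Proof.
intros [M HM] [N HN]; exists (M + N); intros z.
apply Rle_trans with (1 := Cmod_triangle _ _).
now apply Rplus_le_compat.
Qed.

Lemma bounded_scal c f : bounded f -> bounded (fun z => (c * f z)%C).
Proof.
intros [M HM]; exists (Cmod c * M); intros z; rewrite Cmod_mult.
apply Rmult_le_compat_l; [apply Cmod_ge_0 | apply HM].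
Qed.

Lemma extends_zero : extends_continuously (fun _ => 0%C).
Proof.
exists (fun _ => 0%C); split; [|easy].
intros x _; apply filterlim_const.
Qed.

Lemma extends_plus f g :
  extends_continuously f -> extends_continuously g ->
  extends_continuously (fun z => (f z + g z)%C).
Proof.
intros [F [HF EF]] [G [HG EG]]; exists (fun z => (F z + G z)%C); split.
  intros x Hx.
  apply (filterlim_comp_2 (G := locally (F x)) (H := locally (G x)) F G Cplus).
  - now apply HF.
  - now apply HG.
  - apply (filterlim_plus (F x : C_NormedModule) (G x)).
now intros z; rewrite EF, EG.
Qed.

Lemma extends_scal c f :
  extends_continuously f -> extends_continuously (fun z => (c * f z)%C).
Proof.
intros [F [HF EF]]; exists (fun z => (c * F z)%C); split.
  intros x Hx.
  apply (filterlim_comp _ _ _ F (Cmult c) _ (locally (F x))).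
  - now apply HF.
  - apply (filterlim_scal_r (V := C_NormedModule) c (F x)).
now intros z; rewrite EF.
Qed.

Lemma extends_bounded f : extends_continuously f -> bounded f.
Proof.
intros [F [HF EF]].
assert (Hd : forall u v : R, exists d : posreal, forall x y : R,
  Cmod (x, y) <= 1 -> Rabs (x - u) < d -> Rabs (y - v) < d ->
  Cmod (F (x, y)) <= / d).
{ intros u v.
  destruct (Rle_lt_dec (Cmod (u, v)) 1) as [H|H].
  - assert (L := HF (u, v) H).
    assert (L' := proj1 (filterlim_locally F _) L (mkposreal 1 Rlt_0_1)).
    destruct L' as [e He].
    set (M := Cmod (F (u, v)) + 2).
    assert (HM : 0 < M) by (unfold M; generalize (Cmod_ge_0 (F (u, v))); lra).
    assert (Hm : 0 < Rmin e (/ M)).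
    { apply Rmin_glb_lt; [apply cond_pos | now apply Rinv_0_lt_compat]. }
    exists (mkposreal _ Hm); simpl; intros x y Hxy Hx Hy.
    apply Rle_trans with M.
    + assert (B : @ball C_UniformSpace (F (u, v)) 1 (F (x, y))).
      { apply (He (x, y)); [|exact Hxy]; split; simpl.
        - apply Rlt_le_trans with (1 := Hx), Rmin_l.
        - apply Rlt_le_trans with (1 := Hy), Rmin_l. }
      destruct B as [B1 B2].
      change (Rabs (fst (F (x, y)) - fst (F (u, v))) < 1) in B1.
      change (Rabs (snd (F (x, y)) - snd (F (u, v))) < 1) in B2.
      replace (F (x, y)) with (F (u, v) + (F (x, y) - F (u, v)))%C by ring.
      apply Rle_trans with (1 := Cmod_triangle _ _).
      unfold M; apply Rplus_le_compat_l.
      apply Rle_trans with (1 := Cmod_2Rmax _).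
      apply Rle_trans with (sqrt 2 * 1).
      * apply Rmult_le_compat_l; [apply sqrt_pos|].
        apply Rmax_lub; apply Rlt_le; [exact B1 | exact B2].
      * rewrite Rmult_1_r; apply Rle_trans with (sqrt (2 * 2)).
          apply sqrt_le_1; lra.
        rewrite sqrt_square; lra.
    + rewrite <- (Rinv_inv M) at 1.
      apply Rinv_le_contravar; [exact Hm | apply Rmin_r].
  - assert (Hm : 0 < (Cmod (u, v) - 1) / 2) by lra.
    exists (mkposreal _ Hm); simpl; intros x y Hxy Hx Hy; exfalso.
    assert (T : Cmod (u, v) <= Cmod (x, y) + Cmod ((u, v) - (x, y))%C).
    { replace (u, v) with ((x, y) + ((u, v) - (x, y)))%C at 1 by ring.
      apply Cmod_triangle. }
    assert (D : Cmod ((u, v) - (x, y))%C < Cmod (u, v) - 1).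
    { apply Rle_lt_trans with (1 := Cmod_2Rmax _); simpl.
      assert (Rmax (Rabs (u + - x)) (Rabs (v + - y)) < (Cmod (u, v) - 1) / 2).
      { apply Rmax_lub_lt; [rewrite Rabs_minus_sym in Hx | rewrite Rabs_minus_sym in Hy];
          assumption. }
      assert (sqrt 2 <= 2).
      { apply Rle_trans with (sqrt (2 * 2)).
          apply sqrt_le_1; lra.
        rewrite sqrt_square; lra. }
      assert (0 <= Rmax (Rabs (u + - x)) (Rabs (v + - y))).
      { apply Rle_trans with (2 := Rmax_l _ _), Rabs_pos. }
      apply Rle_lt_trans with (2 * Rmax (Rabs (u + - x)) (Rabs (v + - y))); [|lra].
      now apply Rmult_le_compat_r. }
    lra. }
set (delta := fun u v => proj1_sig (constructive_indefinite_description _ (Hd u v))).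
assert (Hdelta : forall u v x y : R,
  Cmod (x, y) <= 1 -> Rabs (x - u) < delta u v -> Rabs (y - v) < delta u v ->
  Cmod (F (x, y)) <= / delta u v).
{ intros u v; unfold delta.
  now destruct (constructive_indefinite_description _ (Hd u v)). }
destruct (compactness_value_2d (-1) 1 (-1) 1 delta) as [d H].
exists (/ d); intros [[x y] Hz]; rewrite <- EF; simpl.
assert (Hxy : Rmax (Rabs x) (Rabs y) <= 1).
{ apply Rle_trans with (1 := Rmax_Cmod (x, y)); lra. }
assert (Hx : Rabs x <= 1) by (apply Rle_trans with (2 := Hxy), Rmax_l).
assert (Hy : Rabs y <= 1) by (apply Rle_trans with (2 := Hxy), Rmax_r).
apply Rabs_le_between in Hx; apply Rabs_le_between in Hy.
destruct (Rle_lt_dec (Cmod (F (x, y))) (/ d)) as [K|K]; [exact K|].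
exfalso; apply (H x y Hx Hy); intros [u [v [_ [_ [Hu [Hv Hle]]]]]].
apply (Rlt_not_le _ _ K).
apply Rle_trans with (/ delta u v).
  apply Hdelta; [lra | exact Hu | exact Hv].
apply Rinv_le_contravar; [apply cond_pos | exact Hle].
Qed.

Program Definition H_infty : function_space :=
  {| fs_mem := fun f => analytic f /\ bounded f |}.
Next Obligation. split; [apply analytic_zero | apply bounded_zero]. Qed.
Next Obligation. split; [now apply analytic_plus | now apply bounded_plus]. Qed.
Next Obligation. split; [now apply analytic_scal | now apply bounded_scal]. Qed.

(* A function continuous on the closed disk is determined by its restriction to
   the open disk, so the disk algebra is realized as a space of functions on the
   open disk; the supremum norm is not affected by the restriction. *)
Program Definition disk_algebra : function_space :=
  {| fs_mem := fun f => analytic f /\ extends_continuously f |}.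
Next Obligation. split; [apply analytic_zero | apply extends_zero]. Qed.
Next Obligation. split; [now apply analytic_plus | now apply extends_plus]. Qed.
Next Obligation. split; [now apply analytic_scal | now apply extends_scal]. Qed.
Next Obligation. now apply extends_bounded. Qed.

Lemma sup_norm_ub f : bounded f -> forall z, Cmod (f z) <= sup_norm f.
Proof.
intros [M HM] z; unfold sup_norm.
destruct (Lub_Rbar_correct (fun r => exists z, r = Cmod (f z))) as [H1 H2].
assert (L : Rbar_le (Cmod (f z)) (Lub_Rbar (fun r => exists z, r = Cmod (f z)))).
  apply H1; now exists z.
assert (U : Rbar_le (Lub_Rbar (fun r => exists z, r = Cmod (f z))) M).
  apply H2; intros r [w ->]; apply HM.
now destruct (Lub_Rbar _).
Qed.

Lemma sup_norm_le f M : (forall z, Cmod (f z) <= M) -> sup_norm f <= M.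
Proof.
intros HM; unfold sup_norm.
destruct (Lub_Rbar_correct (fun r => exists z, r = Cmod (f z))) as [H1 H2].
assert (L : Rbar_le (Cmod (f disk0)) (Lub_Rbar (fun r => exists z, r = Cmod (f z)))).
  apply H1; now exists disk0.
assert (U : Rbar_le (Lub_Rbar (fun r => exists z, r = Cmod (f z))) M).
  apply H2; intros r [w ->]; apply HM.
now destruct (Lub_Rbar _).
Qed.

Section NormedSpace.

Variable A : function_space.

Definition fs_sort : Type := {f : disk -> C | A f}.

Definition fs_fun (f : fs_sort) : disk -> C := proj1_sig f.

Lemma fs_eq (f g : fs_sort) : (forall z, fs_fun f z = fs_fun g z) -> f = g.
Proof.
destruct f as [f Hf], g as [g Hg]; simpl; intros H.
assert (E : f = g) by now apply functional_extensionality.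
subst g; f_equal; apply proof_irrelevance.
Qed.

Definition fs_add (f g : fs_sort) : fs_sort :=
  exist _ _ (fs_plus A _ _ (proj2_sig f) (proj2_sig g)).
Definition fs_null : fs_sort := exist _ _ (fs_zero A).
Definition fs_smul (c : C) (f : fs_sort) : fs_sort :=
  exist _ _ (fs_scal A c _ (proj2_sig f)).

Definition fs_AbelianMonoid_mixin : AbelianMonoid.mixin_of fs_sort.
Proof.
apply (AbelianMonoid.Mixin _ fs_add fs_null); intros; apply fs_eq; intros ?.
- apply Cplus_comm.
- apply Cplus_assoc.
- apply Cplus_0_r.
Defined.

Canonical fs_AbelianMonoid := AbelianMonoid.Pack fs_sort fs_AbelianMonoid_mixin fs_sort.

Definition fs_AbelianGroup_mixin : AbelianGroup.mixin_of fs_AbelianMonoid.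
Proof.
apply (AbelianGroup.Mixin fs_AbelianMonoid (fs_smul (-1)%C)).
intros f; apply fs_eq; intros z.
change (fs_fun f z + -1 * fs_fun f z = 0)%C; ring.
Defined.

Canonical fs_AbelianGroup := AbelianGroup.Pack fs_sort
  (AbelianGroup.Class _ _ fs_AbelianGroup_mixin) fs_sort.

Definition fs_ModuleSpace_mixin : ModuleSpace.mixin_of C_Ring fs_AbelianGroup.
Proof.
apply (ModuleSpace.Mixin C_Ring fs_AbelianGroup fs_smul);
  intros; apply fs_eq; intros ?; simpl.
- apply Cmult_assoc.
- apply Cmult_1_l.
- apply Cmult_plus_distr_l.
- apply Cmult_plus_distr_r.
Defined.

Canonical fs_ModuleSpace := ModuleSpace.Pack C_Ring fs_sort
  (ModuleSpace.Class _ _ _ fs_ModuleSpace_mixin) fs_sort.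

Definition fs_norm (f : fs_sort) : R := sup_norm (fs_fun f).

Definition fs_ball (f : fs_sort) (e : R) (g : fs_sort) : Prop :=
  fs_norm (minus g f) < e.

Lemma fs_norm_ub (f : fs_sort) z : Cmod (fs_fun f z) <= fs_norm f.
Proof. apply sup_norm_ub, (fs_bounded A), (proj2_sig f). Qed.

Lemma fs_norm_plus (f g : fs_sort) : fs_norm (plus f g) <= fs_norm f + fs_norm g.
Proof.
apply sup_norm_le; intros z; simpl.
apply Rle_trans with (1 := Cmod_triangle _ _).
apply Rplus_le_compat; apply fs_norm_ub.
Qed.

Lemma fs_norm_scal (c : C) (f : fs_sort) :
  fs_norm (fs_smul c f) <= Cmod c * fs_norm f.
Proof.
apply sup_norm_le; intros z; simpl; rewrite Cmod_mult.
apply Rmult_le_compat_l; [apply Cmod_ge_0 | apply fs_norm_ub].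
Qed.

Lemma fs_norm_eq0 (f : fs_sort) : fs_norm f = 0 -> f = zero.
Proof.
intros H; apply fs_eq; intros z; simpl; apply Cmod_eq_0.
apply Rle_antisym; [rewrite <- H; apply fs_norm_ub | apply Cmod_ge_0].
Qed.

Lemma fs_ball_center (f : fs_sort) (e : posreal) : fs_ball f e f.
Proof.
apply Rle_lt_trans with 0; [|apply cond_pos].
apply sup_norm_le; intros z.
change (Cmod (fs_fun f z + -1 * fs_fun f z)%C <= 0).
replace (fs_fun f z + -1 * fs_fun f z)%C with (RtoC 0) by ring.
rewrite Cmod_0; lra.
Qed.

Lemma fs_ball_sym (f g : fs_sort) (e : R) : fs_ball f e g -> fs_ball g e f.
Proof.
unfold fs_ball; intros H.
assert (E : minus f g = fs_smul (-1)%C (minus g f)).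
  apply fs_eq; intros z.
  change (fs_fun f z + -1 * fs_fun g z = -1 * (fs_fun g z + -1 * fs_fun f z))%C; ring.
rewrite E; apply Rle_lt_trans with (1 := fs_norm_scal _ _).
rewrite Cmod_R, Rabs_left by lra; lra.
Qed.

Lemma fs_ball_triangle (f g h : fs_sort) (e1 e2 : R) :
  fs_ball f e1 g -> fs_ball g e2 h -> fs_ball f (e1 + e2) h.
Proof.
unfold fs_ball; intros H1 H2.
assert (E : minus h f = plus (minus g f) (minus h g)).
  apply fs_eq; intros z.
  change (fs_fun h z + -1 * fs_fun f z
    = (fs_fun g z + -1 * fs_fun f z) + (fs_fun h z + -1 * fs_fun g z))%C; ring.
rewrite E; apply Rle_lt_trans with (1 := fs_norm_plus _ _); lra.
Qed.

Definition fs_UniformSpace_mixin : UniformSpace.mixin_of fs_sort :=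
  UniformSpace.Mixin fs_sort fs_null fs_ball
    fs_ball_center fs_ball_sym fs_ball_triangle.

Canonical fs_UniformSpace := UniformSpace.Pack fs_sort fs_UniformSpace_mixin fs_sort.

Canonical fs_NormedModuleAux := NormedModuleAux.Pack C_AbsRing fs_sort
  (NormedModuleAux.Class C_AbsRing fs_sort
    (ModuleSpace.class C_Ring fs_ModuleSpace) fs_UniformSpace_mixin) fs_sort.

Definition fs_NormedModule_mixin : NormedModule.mixin_of C_AbsRing fs_NormedModuleAux.
Proof.
apply (NormedModule.Mixin C_AbsRing fs_NormedModuleAux fs_norm 1).
- exact fs_norm_plus.
- exact fs_norm_scal.
- easy.
- intros f g e H; now rewrite Rmult_1_l.
- exact fs_norm_eq0.
Defined.

Canonical fs_NormedModule := NormedModule.Pack C_AbsRing fs_sort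
  (NormedModule.Class C_AbsRing fs_sort
    (NormedModuleAux.class C_AbsRing fs_NormedModuleAux) fs_NormedModule_mixin) fs_sort.

Variable phi : disk -> disk.

Definition induces_composition : Prop :=
  forall f : disk -> C, A f -> A (fun z => f (phi z)).

Definition composition_operator (H : induces_composition) (f : fs_NormedModule) :
  fs_NormedModule := exist _ _ (H (fs_fun f) (proj2_sig f)).

Lemma composition_operator_is_linear (H : induces_composition) :
  is_linear (composition_operator H).
Proof.
split.
- intros f g; now apply fs_eq.
- intros c f; now apply fs_eq.
- exists 1; split; [lra|]; intros f; rewrite Rmult_1_l.
  apply sup_norm_le; intros z; apply (fs_norm_ub f (phi z)).
Qed.

End NormedSpace.

Definition recurrent {K : AbsRing} {X : NormedModule K} (T : X -> X) : Prop :=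
  forall U : X -> Prop, open U -> (exists x, U x) ->
    exists k : nat, (0 < k)%nat /\ exists x, U x /\ U (Nat.iter k T x).

Definition conformal_automorphism (phi : disk -> disk) : Prop :=
  analytic (fun z => phi z) /\
  exists psi : disk -> disk, analytic (fun z => psi z) /\
    (forall z, psi (phi z) = z) /\ (forall z, phi (psi z) = z).

Definition elliptic_automorphism (phi : disk -> disk) : Prop :=
  conformal_automorphism phi /\ exists z : disk, phi z = z.

(* Main.v *)
Require Import Defs.
From Stdlib Require Import Reals Lra Lia ProofIrrelevance ClassicalEpsilon.
From Coquelicot Require Import Coquelicot.

(** The identity function J belongs to A.  If the composition operator of phi is
    recurrent, some f close to J has f o phi^k close to J with k >= 1, and then phi^k is
    uniformly close to J ([recurrent_iterates_near_id]).  So there are times k_n >= 1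
    such that phi^(k_n) converges pointwise to the identity of the disk.

    By the Schwarz-Pick lemma ([schwarz_pick]) phi contracts the pseudo-hyperbolic
    distance, and if it decreased the distance of a single pair of points, later
    iterates could not restore it.  Hence phi is an isometry ([returning_pdist2_eq]),
    and an analytic isometry is a Moebius automorphism
    z |-> (lam z + b) / (1 + conj(b) lam z) ([pdist2_isometry_is_mobius],
    [mobius_conformal_automorphism]).

    As phi is not elliptic, it has no fixed point in the disk, hence it has a fixed
    point alpha on the unit circle.  In the coordinate 1 / (z - alpha) it is an affine
    map s |-> p s + q with p > 0 and q <> 0: a dilation or a translation, no
    iterates of which approach the identity ([mobius_without_fixed_point_not_returning]).

    The Schwarz-Pick lemma rests on a maximum principle for functions with second-order
    complex expansions ([maximum_principle]): |g|^2 + e |z|^2 has no interior local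
    maximum, as averaging over four points of a small square shows.  This avoids
    Cauchy's integral formula, and expansions pass to products, inverses and difference
    quotients without any rearrangement of series. *)

Open Scope R_scope.

(** * Second-order expansions of complex functions *)

Definition near0 (P : C -> Prop) : Prop :=
  exists r : R, 0 < r /\ forall h : C, Cmod h < r -> P h.

Lemma near0_and (P Q : C -> Prop) :
  near0 P -> near0 Q -> near0 (fun h => P h /\ Q h).
Proof.
intros [r [Hr HP]] [s [Hs HQ]]; exists (Rmin r s); split.
  now apply Rmin_glb_lt.
intros h Hh; split.
- apply HP; apply Rlt_le_trans with (1 := Hh), Rmin_l.
- apply HQ; apply Rlt_le_trans with (1 := Hh), Rmin_r.
Qed.

Lemma near0_imp (P Q : C -> Prop) :
  (forall h, P h -> Q h) -> near0 P -> near0 Q.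
Proof. intros H [r [Hr HP]]; exists r; split; [exact Hr|]; auto. Qed.

Lemma near0_lt (r : R) : 0 < r -> near0 (fun h => Cmod h < r).
Proof. intros Hr; now exists r. Qed.

Definition bounded_near0 (f : C -> C) : Prop :=
  exists K : R, near0 (fun h => Cmod (f h) <= K).

Lemma bounded_near0_const c : bounded_near0 (fun _ => c).
Proof. exists (Cmod c), 1; split; [lra|]; intros; apply Rle_refl. Qed.

Lemma bounded_near0_id : bounded_near0 (fun h => h).
Proof. exists 1, 1; split; [lra|]; intros; lra. Qed.

Lemma bounded_near0_plus f g :
  bounded_near0 f -> bounded_near0 g -> bounded_near0 (fun h => f h + g h)%C.
Proof.
intros [K Hf] [L Hg]; exists (K + L).
generalize (near0_and _ _ Hf Hg); apply near0_imp; intros h [H1 H2].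
apply Rle_trans with (1 := Cmod_triangle _ _); lra.
Qed.

Lemma bounded_near0_mult f g :
  bounded_near0 f -> bounded_near0 g -> bounded_near0 (fun h => f h * g h)%C.
Proof.
intros [K Hf] [L Hg]; exists (K * L).
generalize (near0_and _ _ Hf Hg); apply near0_imp; intros h [H1 H2].
rewrite Cmod_mult; apply Rmult_le_compat; auto using Cmod_ge_0.
Qed.

Ltac bnd0 := repeat first [assumption | apply bounded_near0_const
  | apply bounded_near0_id | apply bounded_near0_plus | apply bounded_near0_mult].

(** Analytic functions enter the maximum principle only through their expansions
    of order two with remainder O(h^3).  That products and inverses have such expansions
    is plain algebra, without rearrangement of series. *)
Definition jet (g : C -> C) (z a b c : C) : Prop :=
  exists rem : C -> C, bounded_near0 rem /\
    near0 (fun h => g (z + h) = a + b * h + c * h * h + h * h * h * rem h)%C.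

Definition has_jet (g : C -> C) (z : C) : Prop :=
  exists a b c : C, jet g z a b c.

Lemma jet_mult f g z a b c a' b' c' :
  jet f z a b c -> jet g z a' b' c' ->
  jet (fun w => f w * g w)%C z (a * a') (a * b' + b * a')
    (a * c' + b * b' + c * a').
Proof.
intros [rem [Hrem Hf]] [S [HS Hg]].
exists (fun h => b * c' + c * b' + c * c' * h + rem h * (a' + b' * h + c' * h * h)
  + S h * (a + b * h + c * h * h) + h * h * h * rem h * S h)%C; split.
  bnd0.
generalize (near0_and _ _ Hf Hg); apply near0_imp; intros h [-> ->]; ring.
Qed.

Lemma jet_ext_near f g z a b c :
  near0 (fun h => f (z + h) = g (z + h))%C -> jet f z a b c -> jet g z a b c.
Proof.
intros E [rem [Hrem Hf]]; exists rem; split; [exact Hrem|].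
generalize (near0_and _ _ E Hf); apply near0_imp; intros h [<- ->]; reflexivity.
Qed.

Lemma jet_value g z a b c : jet g z a b c -> g z = a.
Proof.
intros [rem [_ [r [Hr H]]]].
specialize (H 0%C); rewrite Cmod_0, Cplus_0_r in H.
rewrite H by exact Hr; ring.
Qed.

Lemma jet_lipschitz g z a b c : jet g z a b c ->
  exists K : R, 0 < K /\ near0 (fun h => Cmod (g (z + h) - g z)%C <= K * Cmod h).
Proof.
intros J; rewrite (jet_value _ _ _ _ _ J); destruct J as [rem [Hrem Hg]].
assert (B : bounded_near0 (fun h => b + c * h + h * h * rem h)%C) by bnd0.
destruct B as [K HK]; exists (Rmax K 1); split.
  apply Rlt_le_trans with (2 := Rmax_r _ _); lra.
generalize (near0_and _ _ Hg HK); apply near0_imp; intros h [-> H].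
replace (a + b * h + c * h * h + h * h * h * rem h - a)%C
  with ((b + c * h + h * h * rem h) * h)%C by ring.
rewrite Cmod_mult; apply Rmult_le_compat_r; [apply Cmod_ge_0|].
apply Rle_trans with (1 := H), Rmax_l.
Qed.

(** The second-order expansion q of 1/g is found formally; then g * q = 1 + O(h^3),
    and dividing by g, which stays away from 0, turns this into an expansion of 1/g. *)
Lemma jet_inv g z : has_jet g z -> g z <> 0%C -> has_jet (fun w => / g w)%C z.
Proof.
intros [a [b [c J]]] Hz.
assert (Ea := jet_value _ _ _ _ _ J); rewrite Ea in Hz.
set (q := fun w : C => (/ a + - b / (a * a) * (w - z)
   + (b * b / (a * a * a) - c / (a * a)) * (w - z) * (w - z))%C).
assert (Jq : jet q z (/ a) (- b / (a * a)) (b * b / (a * a * a) - c / (a * a))).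
{ exists (fun _ => 0%C); split; [bnd0|].
  exists 1; split; [lra|]; intros h _; unfold q.
  replace (z + h - z)%C with h by ring; ring. }
assert (L := jet_lipschitz _ _ _ _ _ J); destruct L as [K [HK L]]; rewrite Ea in L.
destruct (jet_mult _ _ _ _ _ _ _ _ _ J Jq) as [T [HT E]].
assert (Ha : 0 < Cmod a) by now apply Cmod_gt_0.
assert (N : near0 (fun h => Cmod a / 2 <= Cmod (g (z + h)))%C).
{ assert (Hd : 0 < Cmod a / (2 * K)).
    apply Rdiv_lt_0_compat; lra.
  generalize (near0_and _ _ L (near0_lt _ Hd)); apply near0_imp; intros h [H1 H2].
  assert (T1 : Cmod a <= Cmod (g (z + h))%C + Cmod (g (z + h) - a)%C).
  { replace a with (g (z + h) + - (g (z + h) - a))%C at 1 by ring.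
    rewrite <- (Cmod_opp (g (z + h) - a)%C); apply Cmod_triangle. }
  assert (K * Cmod h <= K * (Cmod a / (2 * K))).
    apply Rmult_le_compat_l; lra.
  replace (K * (Cmod a / (2 * K))) with (Cmod a / 2) in H by (field; lra).
  lra. }
exists (/ a)%C, (- b / (a * a))%C, (b * b / (a * a * a) - c / (a * a))%C.
exists (fun h => (- (1)) * T h * / g (z + h))%C; split.
- repeat apply bounded_near0_mult; try exact HT; try bnd0.
  exists (2 / Cmod a); revert N; apply near0_imp; intros h H.
  rewrite Cmod_inv.
    replace (2 / Cmod a) with (/ (Cmod a / 2)) by (field; lra).
    apply Rinv_le_contravar; lra.
  apply Cmod_gt_0; lra.
- generalize (near0_and _ _ N E); apply near0_imp; intros h [H1 H2].
  assert (G : g (z + h)%C <> 0%C) by (apply Cmod_gt_0; lra).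
  unfold q in H2; replace (z + h - z)%C with h in H2 by ring.
  set (Q := (/ a + - b / (a * a) * h + (b * b / (a * a * a) - c / (a * a)) * h * h)%C) in *.
  assert (H3 : (g (z + h) * Q = 1 + h * h * h * T h)%C).
    rewrite H2; field; exact Hz.
  apply (f_equal (fun x => x / g (z + h))%C) in H3.
  replace (g (z + h) * Q / g (z + h))%C with Q in H3 by (field; exact G).
  rewrite H3; field; exact G.
Qed.

(** * Power series and difference quotients *)

Lemma is_series_C (u : nat -> C) (l : C) : is_series u l ->
  forall e : R, 0 < e -> exists N : nat, forall n : nat, (N <= n)%nat ->
    Cmod (sum_n u n - l)%C < e.
Proof.
intros H e He.
destruct (proj1 (filterlim_locally_ball_norm (U := C_NormedModule) _ _) H
  (mkposreal e He)) as [N HN].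
exists N; intros n Hn; exact (HN n Hn).
Qed.

Lemma pow_n_C (z : C) (n : nat) : pow_n z n = (z ^ n)%C.
Proof. induction n as [|n IH]; [reflexivity|]; rewrite Cpow_S, <- IH; reflexivity. Qed.

Lemma pow_n_Cmod (z : C) (n : nat) : Cmod (pow_n z n) = Cmod z ^ n.
Proof. rewrite pow_n_C; apply Cmod_pow. Qed.

Lemma sequence_bounded (x : nat -> R) (N : nat) (B : R) :
  (forall n, (N <= n)%nat -> x n <= B) -> exists M : R, forall n, x n <= M.
Proof.
revert B; induction N as [|N IH]; intros B H.
  exists B; intros n; apply H; lia.
apply (IH (Rmax B (x N))); intros n Hn.
destruct (Nat.eq_dec n N) as [->|E]; [apply Rmax_r|].
apply Rle_trans with (2 := Rmax_l _ _), H; lia.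
Qed.

Lemma is_pseries_bounded_terms (a : nat -> C) (h l : C) : is_pseries a h l ->
  exists M : R, forall n, Cmod (a n) * Cmod h ^ n <= M.
Proof.
intros H; destruct (is_series_C _ _ H 1 Rlt_0_1) as [N HN].
apply (sequence_bounded _ (S N) 2); intros [|n] Hn; [lia|].
assert (H1 := HN (S n) ltac:(lia)); assert (H2 := HN n ltac:(lia)).
rewrite sum_Sn in H1; set (s := sum_n _ n) in *.
change (Cmod (s + pow_n h (S n) * a (S n) - l)%C < 1) in H1.
rewrite <- pow_n_Cmod, <- Cmod_mult.
replace (a (S n) * pow_n h (S n))%C
  with ((s + pow_n h (S n) * a (S n) - l) + - (s - l))%C by ring.
apply Rle_trans with (1 := Cmod_triangle _ _); rewrite Cmod_opp; lra.
Qed.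

(** Within half of a radius at which the terms stay bounded, the tail is dominated by
    a geometric series of ratio 1/2. *)
Lemma pseries_remainder (a : nat -> C) (rho M : R) (h l : C) (N : nat) :
  0 < rho -> (forall n, Cmod (a n) * rho ^ n <= M) -> Cmod h <= rho / 2 ->
  is_pseries a h l ->
  Cmod (l - sum_n (fun k => pow_n h k * a k)%C N) <= 2 * M * (Cmod h / rho) ^ S N.
Proof.
intros Hr HM Hh Hl; set (u := fun k => (pow_n h k * a k)%C).
set (x := Cmod h / rho).
assert (Hx : 0 <= x <= / 2).
{ split; unfold x.
    apply Rdiv_le_0_compat; [apply Cmod_ge_0 | exact Hr].
  apply Rmult_le_reg_r with (1 := Hr); unfold Rdiv; rewrite Rmult_assoc, Rinv_l; lra. }
assert (M0 : 0 <= M).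
{ apply Rle_trans with (2 := HM 0%nat); simpl; rewrite Rmult_1_r; apply Cmod_ge_0. }
assert (Hu : forall k, Cmod (u k) <= M * x ^ k).
{ intros k; unfold u; rewrite Cmod_mult, pow_n_Cmod.
  replace (Cmod h) with (x * rho) by (unfold x; field; lra).
  rewrite Rpow_mult_distr.
  replace (x ^ k * rho ^ k * Cmod (a k)) with (Cmod (a k) * rho ^ k * x ^ k) by ring.
  apply Rmult_le_compat_r; [apply pow_le; lra | apply HM]. }
assert (B : forall m, Cmod (sum_n u (N + m) - sum_n u N)%C
    <= 2 * M * x ^ S N * (1 - (/ 2) ^ m)).
{ induction m as [|m IH].
    rewrite Nat.add_0_r.
    replace (sum_n u N - sum_n u N)%C with (RtoC 0) by ring.
    rewrite Cmod_0; simpl; lra.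
  rewrite Nat.add_succ_r, sum_Sn.
  replace (plus (sum_n u (N + m)) (u (S (N + m))) - sum_n u N)%C
    with ((sum_n u (N + m) - sum_n u N) + u (S (N + m)))%C
    by (change (plus (sum_n u (N + m)) (u (S (N + m))))
          with (sum_n u (N + m) + u (S (N + m)))%C; ring).
  apply Rle_trans with (1 := Cmod_triangle _ _).
  assert (H1 : M * x ^ S (N + m) <= M * x ^ S N * (/ 2) ^ m).
  { rewrite <- Nat.add_succ_l, pow_add, Rmult_assoc.
    apply Rmult_le_compat_l; [exact M0|].
    apply Rmult_le_compat_l; [apply pow_le; lra|].
    apply pow_incr; lra. }
  assert (H2 := Hu (S (N + m))).
  change ((/ 2) ^ S m) with (/ 2 * (/ 2) ^ m).
  replace (2 * M * x ^ S N * (1 - / 2 * (/ 2) ^ m))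
    with (2 * M * x ^ S N * (1 - (/ 2) ^ m) + M * x ^ S N * (/ 2) ^ m) by field.
  apply Rplus_le_compat; [exact IH | exact (Rle_trans _ _ _ H2 H1)]. }
apply le_epsilon; intros e He.
destruct (is_series_C _ _ Hl e He) as [n0 Hn0].
assert (H1 := Hn0 (N + n0)%nat ltac:(lia)); assert (H2 := B n0).
change (Cmod (sum_n u (N + n0) - l)%C < e) in H1.
replace (l - sum_n u N)%C
  with (- (sum_n u (N + n0) - l) + (sum_n u (N + n0) - sum_n u N))%C by ring.
apply Rle_trans with (1 := Cmod_triangle _ _); rewrite Cmod_opp.
apply Rle_trans with (1 := Rplus_le_compat _ _ _ _ (Rlt_le _ _ H1) H2).
assert (0 <= 2 * M * x ^ S N * (/ 2) ^ n0).
{ apply Rmult_le_pos; [|apply pow_le; lra].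
  apply Rmult_le_pos; [lra | apply pow_le; lra]. }
lra.
Qed.

(** Extension by 0, so that complex arithmetic can be done without carrying proofs
    of membership in the disk. *)
Definition extend (f : disk -> C) (z : C) : C :=
  match Rlt_dec (Cmod z) 1 with
  | left H => f (exist _ z H)
  | right _ => 0%C
  end.

Lemma extend_disk (f : disk -> C) (z : disk) : extend f z = f z.
Proof.
unfold extend; destruct z as [z Hz]; simpl.
destruct (Rlt_dec (Cmod z) 1) as [H|H]; [|contradiction].
f_equal; f_equal; apply proof_irrelevance.
Qed.

Lemma extend_self_map (phi : disk -> disk) (x : C) :
  Cmod x < 1 -> Cmod (extend (fun z => phi z) x) < 1.
Proof.
intros Hx; change x with (disk_val (exist _ x Hx)).
rewrite extend_disk; exact (proj2_sig (phi _)).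
Qed.

(** One order more than in [jet]: a difference quotient loses one order at its base
    point. *)
Definition cubic_jet (g : C -> C) (z : C) : Prop :=
  exists (a b c d : C) (rem : C -> C), bounded_near0 rem /\
    near0 (fun h => g (z + h)
      = a + b * h + c * h * h + d * h * h * h + h * h * h * h * rem h)%C.

Lemma near0_disk (z : C) : Cmod z < 1 -> near0 (fun h => Cmod (z + h)%C < 1).
Proof.
intros Hz; exists (1 - Cmod z); split; [lra|]; intros h Hh.
apply Rle_lt_trans with (1 := Cmod_triangle _ _); lra.
Qed.

Lemma analytic_cubic_jet (f : disk -> C) (z : C) :
  analytic f -> Cmod z < 1 -> cubic_jet (extend f) z.
Proof.
intros Hf Hz; destruct (Hf (exist _ z Hz)) as [a [r [Hr Ha]]]; simpl in Ha.
destruct (near0_disk z Hz) as [s [Hs Hd]].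
set (t := Rmin r s / 2).
assert (Hrs : 0 < Rmin r s) by now apply Rmin_glb_lt.
assert (Ht : 0 < t) by (unfold t; lra).
assert (Htr : t < r) by (generalize (Rmin_l r s); unfold t; lra).
assert (Hts : t < s) by (generalize (Rmin_r r s); unfold t; lra).
assert (P : forall h, Cmod h <= t -> is_pseries a h (extend f (z + h)%C)).
{ intros h Hh.
  assert (Hzh : Cmod (z + h)%C < 1) by (apply Hd; lra).
  assert (E : (z + h - z)%C = h) by ring.
  assert (Q := Ha (exist _ (z + h)%C Hzh)); simpl in Q; rewrite E in Q.
  rewrite <- (extend_disk f) in Q; apply Q; lra. }
assert (Ct : Cmod t = t) by (rewrite Cmod_R; apply Rabs_pos_eq; lra).
destruct (is_pseries_bounded_terms _ _ _ (P t ltac:(lra))) as [M HM].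
rewrite Ct in HM.
set (p := fun h : C => (a 0%nat + a 1%nat * h + a 2%nat * h * h
  + a 3%nat * h * h * h)%C).
assert (Rem : forall h, Cmod h <= t / 2 ->
  Cmod (extend f (z + h)%C - p h)%C <= 2 * M * (Cmod h / t) ^ 4).
{ intros h Hh.
  assert (Q := pseries_remainder a t M h _ 3 Ht HM Hh (P h ltac:(lra))).
  replace (p h) with (sum_n (fun k => pow_n h k * a k)%C 3); [exact Q|].
  rewrite !sum_Sn, sum_O, !pow_n_C; unfold p.
  change (h ^ 0 * a 0%nat + h ^ 1 * a 1%nat + h ^ 2 * a 2%nat + h ^ 3 * a 3%nat
    = a 0%nat + a 1%nat * h + a 2%nat * h * h + a 3%nat * h * h * h)%C; ring. }
exists (a 0%nat), (a 1%nat), (a 2%nat), (a 3%nat),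
  (fun h => (extend f (z + h) - p h) * / (h * h * h * h))%C; split.
- exists (2 * M * (/ t) ^ 4), (t / 2); split; [lra|]; intros h Hh.
  assert (M0 : 0 <= M).
  { apply Rle_trans with (2 := HM 0%nat); simpl; rewrite Rmult_1_r; apply Cmod_ge_0. }
  destruct (Ceq_dec h 0) as [->|Nh].
  + replace ((extend f (z + 0) - p 0) * / (0 * 0 * 0 * 0))%C with (RtoC 0).
      rewrite Cmod_0; apply Rmult_le_pos; [lra|].
      now apply pow_le, Rlt_le, Rinv_0_lt_compat.
    assert (Q := Rem 0%C); rewrite Cmod_0 in Q.
    replace (2 * M * (0 / t) ^ 4) with 0 in Q by (field; lra).
    rewrite (Cmod_eq_0 (extend f (z + 0) - p 0)%C); [ring|].
    apply Rle_antisym; [apply Q; lra | apply Cmod_ge_0].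
  + assert (H0 : 0 < Cmod h) by now apply Cmod_gt_0.
    rewrite Cmod_mult, Cmod_inv by now repeat apply Cmult_neq_0.
    rewrite !Cmod_mult.
    apply Rle_trans with
      (2 * M * (Cmod h / t) ^ 4 * / (Cmod h * Cmod h * Cmod h * Cmod h)).
      apply Rmult_le_compat_r; [|apply Rem; lra].
      apply Rlt_le, Rinv_0_lt_compat; repeat apply Rmult_lt_0_compat; exact H0.
    apply Req_le; field; lra.
- exists (t / 2); split; [lra|]; intros h Hh.
  destruct (Ceq_dec h 0) as [->|Nh].
  + assert (Q := Rem 0%C); rewrite Cmod_0 in Q.
    replace (2 * M * (0 / t) ^ 4) with 0 in Q by (field; lra).
    assert (E : (extend f (z + 0) - p 0)%C = 0%C).
      apply Cmod_eq_0, Rle_antisym; [apply Q; lra | apply Cmod_ge_0].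
    rewrite <- (Cplus_0_r (p 0%C)) at 1; rewrite <- E at 2.
    replace (extend f (z + 0)%C) with (p 0 + (extend f (z + 0) - p 0))%C at 1 by ring.
    rewrite E; unfold p; ring.
  + unfold p; field; exact Nh.
Qed.

Lemma cubic_jet_has_jet g z : cubic_jet g z -> has_jet g z.
Proof.
intros [a [b [c [d [rem [Hrem H]]]]]]; exists a, b, c, (fun h => d + h * rem h)%C.
split; [bnd0|]; revert H; apply near0_imp; intros h ->; ring.
Qed.

(** The parameter [d] fills the removable singularity at [w]. *)
Definition difference_quotient (f : C -> C) (w d z : C) : C :=
  if Ceq_dec z w then d else ((f z - f w) / (z - w))%C.

Lemma has_jet_mult f g z :
  has_jet f z -> has_jet g z -> has_jet (fun w => f w * g w)%C z.
Proof.
intros [a [b [c H]]] [a' [b' [c' H']]].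
do 3 eexists; exact (jet_mult _ _ _ _ _ _ _ _ _ H H').
Qed.

Lemma has_jet_affine p q f z : has_jet f z -> has_jet (fun w => p + q * f w)%C z.
Proof.
intros [a [b [c [rem [Hrem H]]]]].
exists (p + q * a)%C, (q * b)%C, (q * c)%C, (fun h => q * rem h)%C; split; [bnd0|].
revert H; apply near0_imp; intros h ->; ring.
Qed.

Lemma has_jet_id z : has_jet (fun w => w) z.
Proof.
exists z, 1%C, 0%C, (fun _ => 0%C); split; [bnd0|].
exists 1; split; [lra|]; intros; ring.
Qed.

Lemma difference_quotient_has_jet f w : cubic_jet f w ->
  exists d : C, forall z, has_jet f z -> has_jet (difference_quotient f w d) z.
Proof.
intros [a [b [c [d [rem [Hrem H]]]]]]; exists b; intros z Hz.
destruct (Ceq_dec z w) as [->|N].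
- exists b, c, d, rem; split; [exact Hrem|].
  assert (Ew : f w = a).
  { destruct H as [r [Hr H]]; specialize (H 0%C); rewrite Cmod_0, Cplus_0_r in H.
    rewrite H by exact Hr; ring. }
  revert H; apply near0_imp; intros h H; unfold difference_quotient.
  destruct (Ceq_dec (w + h)%C w) as [E|E].
  + assert (E0 : h = 0%C) by (replace h with (w + h - w)%C by ring; rewrite E; ring).
    rewrite E0; ring.
  + assert (Nh : h <> 0%C) by (intros ->; apply E; ring).
    rewrite H, Ew; replace (w + h - w)%C with h by ring; field; exact Nh.
- destruct (has_jet_mult (fun x => - f w + 1 * f x)%C (fun x => / (- w + 1 * x))%C z)
    as [a' [b' [c' J]]].
  + now apply has_jet_affine.
  + apply jet_inv; [apply has_jet_affine, has_jet_id|].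
    intros E; apply N; replace z with (- w + 1 * z + w)%C by ring; rewrite E; ring.
  + exists a', b', c'; revert J; apply jet_ext_near.
    exists (Cmod (z - w)%C); split.
      apply Cmod_gt_0; intros E; apply N.
      replace z with (z - w + w)%C by ring; rewrite E; ring.
    intros h Hh; unfold difference_quotient.
    destruct (Ceq_dec (z + h)%C w) as [E|E].
      exfalso; apply (Rlt_irrefl (Cmod h)).
      rewrite <- E in Hh.
      replace (z - (z + h))%C with (- h)%C in Hh by ring.
      now rewrite Cmod_opp in Hh.
    unfold Cdiv; f_equal; [|f_equal]; ring.
Qed.

(** * The maximum principle *)

Lemma Cmod_dist (x y : C) : Rabs (Cmod x - Cmod y) <= Cmod (x - y)%C.
Proof.
assert (H1 : Cmod x <= Cmod y + Cmod (x - y)%C).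
{ replace x with (y + (x - y))%C at 1 by ring; apply Cmod_triangle. }
assert (H2 : Cmod y <= Cmod x + Cmod (x - y)%C).
{ rewrite <- (Cmod_opp (x - y)%C).
  replace y with (x + - (x - y))%C at 1 by ring; apply Cmod_triangle. }
apply Rabs_le; lra.
Qed.

(** Compactness of the closed disk, obtained from that of the square around it: points
    of the square outside of the disk have neighbourhoods that miss the disk. *)
Lemma locally_bounded_on_disk (rho : R) (u : C -> R) :
  (forall p, Cmod p <= rho -> exists B : R, near0 (fun h => u (p + h)%C <= B)) ->
  exists B : R, forall q, Cmod q <= rho -> u q <= B.
Proof.
intros H.
assert (Hd : forall x y : R, exists d : posreal, forall x' y' : R,
  Cmod (x', y') <= rho -> Rabs (x' - x) < d -> Rabs (y' - y) < d ->
  u (x', y') <= / d).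
{ intros x y.
  assert (E : exists (d B : R), 0 < d /\ forall q, Cmod q <= rho ->
    Cmod (q - (x, y))%C < d -> u q <= B).
  { destruct (Rle_lt_dec (Cmod (x, y)) rho) as [L|L].
    - destruct (H _ L) as [B [d [Hd HB]]]; exists d, B; split; [exact Hd|].
      intros q _ Hq; replace q with ((x, y) + (q - (x, y)))%C by ring.
      now apply HB.
    - exists (Cmod (x, y) - rho), 0; split; [lra|]; intros q Hq Hq'; exfalso.
      assert (D := Cmod_dist q (x, y)); apply Rabs_le_between in D; lra. }
  destruct E as [d [B [Pd E]]].
  assert (Pm : 0 < Rmin (d / 2) (/ Rmax B 1)).
  { apply Rmin_glb_lt; [lra|]; apply Rinv_0_lt_compat.
    apply Rlt_le_trans with (2 := Rmax_r _ _); lra. }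
  exists (mkposreal _ Pm); simpl; intros x' y' Hq Hx Hy.
  apply Rle_trans with (Rmax B 1).
  - apply Rle_trans with (2 := Rmax_l _ _); apply E; [exact Hq|].
    replace ((x', y') - (x, y))%C with (RtoC (x' - x) + Ci * RtoC (y' - y))%C
      by (unfold RtoC, Ci; apply injective_projections; simpl; ring).
    apply Rle_lt_trans with (1 := Cmod_triangle _ _).
    rewrite Cmod_mult, Cmod_Ci, !Cmod_R.
    assert (Hm := Rmin_l (d / 2) (/ Rmax B 1)); lra.
  - rewrite <- (Rinv_inv (Rmax B 1)) at 1.
    apply Rinv_le_contravar; [exact Pm | apply Rmin_r]. }
set (delta := fun x y => proj1_sig (constructive_indefinite_description _ (Hd x y))).
assert (Hdelta : forall x y x' y' : R,
  Cmod (x', y') <= rho -> Rabs (x' - x) < delta x y -> Rabs (y' - y) < delta x y ->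
  u (x', y') <= / delta x y).
{ intros x y; unfold delta.
  now destruct (constructive_indefinite_description _ (Hd x y)). }
destruct (compactness_value_2d (- rho) rho (- rho) rho delta) as [d K].
exists (/ d); intros [x y] Hq.
assert (Hxy := Rmax_Cmod (x, y)); simpl in Hxy.
assert (Hx : Rabs x <= rho) by (generalize (Rmax_l (Rabs x) (Rabs y)); lra).
assert (Hy : Rabs y <= rho) by (generalize (Rmax_r (Rabs x) (Rabs y)); lra).
apply Rabs_le_between in Hx; apply Rabs_le_between in Hy.
destruct (Rle_lt_dec (u (x, y)) (/ d)) as [L|L]; [exact L|].
exfalso; apply (K x y Hx Hy); intros [x0 [y0 [_ [_ [Hx0 [Hy0 Hle]]]]]].
apply (Rlt_not_le _ _ L).
apply Rle_trans with (/ delta x0 y0).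
  now apply Hdelta.
apply Rinv_le_contravar; [apply cond_pos | exact Hle].
Qed.

(** If the supremum M were not attained, 1 / (M - u) would be locally bounded, hence
    bounded, which keeps u away from M. *)
Lemma maximum_on_disk (rho : R) (u : C -> R) : 0 <= rho ->
  (forall p, Cmod p <= rho ->
     exists L : R, near0 (fun h => Rabs (u (p + h)%C - u p) <= L * Cmod h)) ->
  exists p, Cmod p <= rho /\ forall q, Cmod q <= rho -> u q <= u p.
Proof.
intros Hrho Hu.
assert (Cont : forall p, Cmod p <= rho -> forall e, 0 < e ->
  near0 (fun h => Rabs (u (p + h)%C - u p) <= e)).
{ intros p Hp e He; destruct (Hu p Hp) as [L HL].
  assert (Pd : 0 < e / Rmax L 1).
  { apply Rdiv_lt_0_compat; [exact He|].
    apply Rlt_le_trans with (2 := Rmax_r _ _); lra. }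
  generalize (near0_and _ _ HL (near0_lt _ Pd)); apply near0_imp; intros h [H1 H2].
  apply Rle_trans with (1 := H1).
  assert (P1 := Rmax_r L 1).
  apply Rle_trans with (Rmax L 1 * Cmod h).
    apply Rmult_le_compat_r; [apply Cmod_ge_0 | apply Rmax_l].
  replace e with (Rmax L 1 * (e / Rmax L 1)) by (field; lra).
  apply Rmult_le_compat_l; lra. }
destruct (locally_bounded_on_disk rho u) as [B HB].
{ intros p Hp; exists (u p + 1); generalize (Cont p Hp 1 Rlt_0_1).
  apply near0_imp; intros h H; apply Rabs_le_between in H; lra. }
assert (H0 : Cmod 0%C <= rho) by (rewrite Cmod_0; exact Hrho).
destruct (completeness (fun r => exists q, Cmod q <= rho /\ r = u q)) as [M [M1 M2]].
  exists B; intros r [q [Hq ->]]; now apply HB.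
  exists (u 0%C), 0%C; auto.
apply NNPP; intros N.
assert (Hlt : forall p, Cmod p <= rho -> u p < M).
{ intros p Hp; apply Rnot_le_lt; intros L; apply N; exists p; split; [exact Hp|].
  intros q Hq; apply Rle_trans with (2 := L), M1; now exists q. }
destruct (locally_bounded_on_disk rho (fun q => / (M - u q))) as [D HD].
{ intros p Hp; assert (P := Hlt p Hp); exists (2 / (M - u p)).
  generalize (Cont p Hp ((M - u p) / 2) ltac:(lra)).
  apply near0_imp; intros h H; apply Rabs_le_between in H.
  replace (2 / (M - u p)) with (/ ((M - u p) / 2)) by (field; lra).
  apply Rinv_le_contravar; lra. }
assert (D0 : 0 < D).
{ apply Rlt_le_trans with (2 := HD _ H0), Rinv_0_lt_compat.
  generalize (Hlt _ H0); lra. }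
assert (M <= M - / D).
{ apply M2; intros r [q [Hq ->]].
  assert (P := Hlt q Hq).
  assert (/ D <= M - u q).
  { rewrite <- (Rinv_inv (M - u q)); apply Rinv_le_contravar; [|now apply HD].
    apply Rinv_0_lt_compat; lra. }
  lra. }
assert (0 < / D) by now apply Rinv_0_lt_compat.
lra.
Qed.

Definition dot (x y : C) : R := Re x * Re y + Im x * Im y.

Lemma dot_self x : dot x x = Cmod x ^ 2.
Proof. rewrite Cmod2_alt; unfold dot; ring. Qed.

Lemma dot_ge x y : - (Cmod x * Cmod y) <= dot x y.
Proof.
assert (H := re_le_Cmod (Cconj x * y)%C).
rewrite Cmod_mult, Cmod_conj in H; apply Rabs_le_between in H.
replace (Re (Cconj x * y)%C) with (dot x y) in H; [lra|].
destruct x, y; unfold dot; simpl; ring.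
Qed.

Lemma Cmod_sqr_plus x y : Cmod (x + y)%C ^ 2 = Cmod x ^ 2 + 2 * dot x y + Cmod y ^ 2.
Proof. rewrite <- !dot_self; destruct x, y; unfold dot; simpl; ring. Qed.

(** Average over the four points p + h with h = t, -t, it, -it.  The terms of g that
    are linear and quadratic in h cancel, so the average of |g|^2 is at least
    |g p|^2 - O(t^3), whereas the penalty e |z|^2 gains e t^2 on average; for small t
    the penalized function therefore exceeds its value at p somewhere. *)
Lemma penalized_no_local_max (g : C -> C) (p : C) (e : R) :
  has_jet g p -> 0 < e ->
  ~ near0 (fun h => Cmod (g (p + h)%C) ^ 2 + e * Cmod (p + h)%C ^ 2
                    <= Cmod (g p) ^ 2 + e * Cmod p ^ 2).
Proof.
intros [a [b [c J]]] He Hmax.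
rewrite (jet_value _ _ _ _ _ J) in Hmax; destruct J as [rem [[K HK] Hrem]].
destruct (near0_and _ _ Hmax (near0_and _ _ HK Hrem)) as [r [Hr H]].
clear Hmax HK Hrem.
assert (K0 : 0 <= K).
{ destruct (H 0%C) as [_ [H0 _]]; [now rewrite Cmod_0|].
  apply Rle_trans with (2 := H0), Cmod_ge_0. }
assert (A0 := Cmod_ge_0 a).
assert (AK : 0 <= Cmod a * K) by now apply Rmult_le_pos.
(* small enough for the average gain e t^2 to exceed the loss of at most 2 |a| K t^3 *)
set (t := Rmin (r / 2) (e / (4 * (Cmod a * K + 1)))).
assert (Ht : 0 < t).
{ apply Rmin_glb_lt; [lra|]; apply Rdiv_lt_0_compat; lra. }
assert (Htr : t < r).
{ apply Rle_lt_trans with (1 := Rmin_l _ _); lra. }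
assert (Hte : t * (Cmod a * K) < e / 2).
{ apply Rle_lt_trans with (e / (4 * (Cmod a * K + 1)) * (Cmod a * K)).
    apply Rmult_le_compat_r; [exact AK | apply Rmin_r].
  apply Rmult_lt_reg_r with (4 * (Cmod a * K + 1)); [lra|].
  replace (e / (4 * (Cmod a * K + 1)) * (Cmod a * K) * (4 * (Cmod a * K + 1)))
    with (e * (Cmod a * K)) by (field; lra).
  assert (0 <= e * (Cmod a * K)) by (apply Rmult_le_pos; lra).
  lra. }
assert (F : forall h, Cmod h = t ->
  2 * dot a (b * h)%C + 2 * dot a (c * h * h)%C + 2 * e * dot p h
    + e * t ^ 2 - 2 * (Cmod a * K) * t ^ 3 <= 0).
{ intros h Eh; destruct (H h) as [H1 [H2 H3]]; [lra|].
  rewrite H3 in H1.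
  replace (a + b * h + c * h * h + h * h * h * rem h)%C
    with (a + (b * h + c * h * h + h * h * h * rem h))%C in H1 by ring.
  set (v := (b * h + c * h * h + h * h * h * rem h)%C) in *.
  rewrite !Cmod_sqr_plus, Eh in H1.
  assert (Ev : dot a v = dot a (b * h)%C + dot a (c * h * h)%C
      + dot a (h * h * h * rem h)%C).
  { unfold v; destruct a, b, c, h, (rem _); unfold dot; simpl; ring. }
  assert (D := dot_ge a (h * h * h * rem h)%C).
  rewrite !Cmod_mult, Eh in D.
  assert (Cmod a * (t * t * t * Cmod (rem h)) <= Cmod a * K * t ^ 3).
  { replace (Cmod a * (t * t * t * Cmod (rem h)))
      with (Cmod a * t ^ 3 * Cmod (rem h)) by ring.
    replace (Cmod a * K * t ^ 3) with (Cmod a * t ^ 3 * K) by ring.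
    apply Rmult_le_compat_l; [|exact H2].
    apply Rmult_le_pos; [exact A0 | apply pow_le; lra]. }
  assert (0 <= Cmod v ^ 2) by apply pow2_ge_0.
  lra. }
assert (Ct : Cmod t = t) by (rewrite Cmod_R; apply Rabs_pos_eq; lra).
assert (F1 := F t Ct).
assert (F2 := F (- t)%C ltac:(now rewrite Cmod_opp)).
assert (F3 := F (Ci * t)%C ltac:(now rewrite Cmod_mult, Cmod_Ci, Ct, Rmult_1_l)).
assert (F4 := F (- (Ci * t))%C
  ltac:(now rewrite Cmod_opp, Cmod_mult, Cmod_Ci, Ct, Rmult_1_l)).
assert (S1 : forall x y : C, dot x (y * t)%C + dot x (y * - t)%C
  + dot x (y * (Ci * t))%C + dot x (y * - (Ci * t))%C = 0).
{ intros [x1 x2] [y1 y2]; unfold dot; simpl; ring. }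
assert (S1' : dot p t + dot p (- t)%C + dot p (Ci * t)%C + dot p (- (Ci * t))%C = 0).
{ destruct p; unfold dot; simpl; ring. }
assert (S2 : dot a (c * t * t)%C + dot a (c * - t * - t)%C
  + dot a (c * (Ci * t) * (Ci * t))%C + dot a (c * - (Ci * t) * - (Ci * t))%C = 0).
{ destruct a, c; unfold dot; simpl; ring. }
specialize (S1 a b).
assert (0 < t ^ 2) by (apply pow_lt; exact Ht).
assert (t ^ 2 * (e - 2 * (t * (Cmod a * K))) <= 0).
{ apply (Rmult_eq_compat_l e) in S1'; rewrite Rmult_0_r in S1'; lra. }
assert (0 < t ^ 2 * (e - 2 * (t * (Cmod a * K)))).
{ apply Rmult_lt_0_compat; lra. }
lra.
Qed.

(** By [penalized_no_local_max], |g|^2 + e |z|^2 takes its maximum over the disk on the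
    boundary circle; then e tends to 0. *)
Lemma maximum_principle (g : C -> C) (rho M : R) : 0 <= rho -> 0 <= M ->
  (forall z, Cmod z <= rho -> has_jet g z) ->
  (forall z, Cmod z = rho -> Cmod (g z) <= M) ->
  forall z, Cmod z <= rho -> Cmod (g z) <= M.
Proof.
intros Hrho HM HJ HB z Hz.
apply Rsqr_incr_0_var; [|exact HM]; rewrite !Rsqr_pow2.
apply le_epsilon; intros e He.
set (e' := e / (rho ^ 2 + 1)).
assert (Hrho2 : 0 <= rho ^ 2) by apply pow2_ge_0.
assert (He' : 0 < e') by (apply Rdiv_lt_0_compat; lra).
assert (Ee : e' * rho ^ 2 <= e).
{ unfold e'; apply Rmult_le_reg_r with (rho ^ 2 + 1); [lra|].
  replace (e / (rho ^ 2 + 1) * rho ^ 2 * (rho ^ 2 + 1)) with (e * rho ^ 2)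
    by (field; lra).
  lra. }
destruct (maximum_on_disk rho (fun w => Cmod (g w) ^ 2 + e' * Cmod w ^ 2) Hrho)
  as [p [Hp Hmax]].
{ intros p Hp; destruct (HJ p Hp) as [a [b [c J]]].
  destruct (jet_lipschitz _ _ _ _ _ J) as [K [HK L]].
  exists (K * (2 * Cmod (g p) + K) + e' * (2 * Cmod p + 1)).
  generalize (near0_and _ _ L (near0_lt 1 Rlt_0_1)); apply near0_imp; intros h [H1 H2].
  assert (D : forall x y k : R, 0 <= x -> 0 <= y -> 0 <= k ->
    Rabs (x - y) <= k * Cmod h -> Rabs (x ^ 2 - y ^ 2) <= k * (2 * y + k) * Cmod h).
  { intros x y k Hx Hy Hk Hd.
    replace (x ^ 2 - y ^ 2) with ((x - y) * (x + y)) by ring.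
    rewrite Rabs_mult, (Rabs_pos_eq (x + y)) by lra.
    replace (k * (2 * y + k) * Cmod h) with (k * Cmod h * (2 * y + k)) by ring.
    assert (k * Cmod h <= k * 1) by (apply Rmult_le_compat_l; lra).
    apply Rmult_le_compat; [apply Rabs_pos | lra | exact Hd|].
    apply Rabs_le_between in Hd; lra. }
  assert (D1 := D (Cmod (g (p + h)%C)) (Cmod (g p)) K (Cmod_ge_0 _) (Cmod_ge_0 _)
    (Rlt_le _ _ HK) (Rle_trans _ _ _ (Cmod_dist _ _) H1)).
  assert (D2 : Rabs (Cmod (p + h)%C ^ 2 - Cmod p ^ 2)
      <= 1 * (2 * Cmod p + 1) * Cmod h).
  { apply D; try apply Cmod_ge_0; [lra|].
    apply Rle_trans with (1 := Cmod_dist _ _).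
    replace (p + h - p)%C with h by ring; lra. }
  replace (Cmod (g (p + h)%C) ^ 2 + e' * Cmod (p + h)%C ^ 2
    - (Cmod (g p) ^ 2 + e' * Cmod p ^ 2))
    with ((Cmod (g (p + h)%C) ^ 2 - Cmod (g p) ^ 2)
      + e' * (Cmod (p + h)%C ^ 2 - Cmod p ^ 2)) by ring.
  apply Rle_trans with (1 := Rabs_triang _ _).
  rewrite Rabs_mult, (Rabs_pos_eq e') by lra.
  apply (Rmult_le_compat_l e') in D2; lra. }
assert (Eb : Cmod p = rho).
{ apply Rle_antisym; [exact Hp|]; apply Rnot_lt_le; intros Lt.
  apply (penalized_no_local_max g p e' (HJ p Hp) He').
  exists (rho - Cmod p); split; [lra|]; intros h Hh; apply Hmax.
  apply Rle_trans with (1 := Cmod_triangle _ _); lra. }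
assert (Q := Hmax z Hz); cbv beta in Q; rewrite Eb in Q.
assert (Cmod (g p) ^ 2 <= M ^ 2).
{ apply pow_incr; split; [apply Cmod_ge_0 | now apply HB]. }
assert (0 <= e' * Cmod z ^ 2).
{ apply Rmult_le_pos; [lra | apply pow2_ge_0]. }
lra.
Qed.

(** * The Schwarz-Pick lemma *)

Lemma Cmod_1_minus_conj_mult (z w : C) :
  Cmod (1 - Cconj w * z)%C ^ 2
  = Cmod (z - w)%C ^ 2 + (1 - Cmod z ^ 2) * (1 - Cmod w ^ 2).
Proof. rewrite !Cmod2_alt; destruct z, w; simpl; ring. Qed.

Lemma Cmod_sqr_lt_1 z : Cmod z < 1 -> 0 < 1 - Cmod z ^ 2.
Proof.
intros H; assert (P := Cmod_ge_0 z).
replace (1 - Cmod z ^ 2) with ((1 - Cmod z) * (1 + Cmod z)) by ring.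
apply Rmult_lt_0_compat; lra.
Qed.

Lemma one_minus_conj_mult_neq_0 (z w : C) :
  Cmod z < 1 -> Cmod w < 1 -> (1 - Cconj w * z)%C <> 0%C.
Proof.
intros Hz Hw E; assert (I := Cmod_1_minus_conj_mult z w).
rewrite E, Cmod_0 in I.
assert (0 < (1 - Cmod z ^ 2) * (1 - Cmod w ^ 2)).
  apply Rmult_lt_0_compat; now apply Cmod_sqr_lt_1.
assert (0 <= Cmod (z - w)%C ^ 2) by apply pow2_ge_0.
simpl in I; lra.
Qed.

Lemma Cmod_le_of_sqr (x y : R) : 0 <= y -> x ^ 2 <= y ^ 2 -> x <= y.
Proof. intros Hy H; apply Rsqr_incr_0_var; [now rewrite !Rsqr_pow2 | exact Hy]. Qed.

(** With rho the pseudo-hyperbolic distance |z - w| / |1 - conj(w) z|, this is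
    rho^2 / (1 - rho^2), an increasing function of rho, which needs only the three
    moduli |z|, |w| and |z - w|. *)
Definition pdist2 (z w : C) : R :=
  Cmod (z - w)%C ^ 2 / ((1 - Cmod z ^ 2) * (1 - Cmod w ^ 2)).

Lemma Cminus_eq_0 (z w : C) : (z - w = 0)%C -> z = w.
Proof. intros E; replace z with (z - w + w)%C by ring; rewrite E; ring. Qed.

(** With b = f w, the function
      G x = ((f x - f w) / (x - w)) * ((1 - conj(w) x) / (1 - conj(b) (f x)))
    has expansions everywhere in the disk.  On the circle |x| = rho the quotient
    |f x - b| / |1 - conj(b) (f x)| is at most 1 and
    |1 - conj(w) x| <= |x - w| + (1 - rho^2), so |G| <= 1 + (1 - rho^2) / (rho - |w|)
    there, hence inside by the maximum principle.  As rho tends to 1 this gives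
    |G| <= 1, which is the contraction property. *)
Lemma schwarz_pick (f : C -> C) :
  (forall z, Cmod z < 1 -> cubic_jet f z) ->
  (forall z, Cmod z < 1 -> Cmod (f z) < 1) ->
  forall z w, Cmod z < 1 -> Cmod w < 1 -> pdist2 (f z) (f w) <= pdist2 z w.
Proof.
intros HJ HS z w Hz Hw.
destruct (Ceq_dec z w) as [->|Nzw].
{ unfold pdist2; replace (f w - f w)%C with (RtoC 0) by ring.
  replace (w - w)%C with (RtoC 0) by ring; rewrite Cmod_0.
  unfold Rdiv; replace (0 ^ 2) with 0 by ring; lra. }
destruct (difference_quotient_has_jet f w (HJ w Hw)) as [d Hd].
set (b := f w); assert (Hb : Cmod b < 1) by now apply HS.
set (G := fun x => (difference_quotient f w d x
  * ((1 + - Cconj w * x) * / (1 + - Cconj b * f x)))%C).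
assert (GJ : forall x, Cmod x < 1 -> has_jet G x).
{ intros x Hx; assert (Jx := cubic_jet_has_jet _ _ (HJ x Hx)).
  unfold G; repeat apply has_jet_mult.
  - now apply Hd.
  - apply has_jet_affine, has_jet_id.
  - apply jet_inv; [now apply has_jet_affine|].
    replace (1 + - Cconj b * f x)%C with (1 - Cconj b * f x)%C by ring.
    apply one_minus_conj_mult_neq_0; [now apply HS | exact Hb]. }
assert (GE : forall x, Cmod x < 1 -> x <> w ->
  Cmod (G x) * (Cmod (x - w)%C * Cmod (1 - Cconj b * f x)%C)
    = Cmod (f x - b)%C * Cmod (1 - Cconj w * x)%C).
{ intros x Hx Nx.
  assert (N1 : (1 - Cconj b * f x)%C <> 0%C).
  { apply one_minus_conj_mult_neq_0; [now apply HS | exact Hb]. }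
  assert (N2 : (x - w)%C <> 0%C) by (intros E; now apply Nx, Cminus_eq_0).
  rewrite <- !Cmod_mult; f_equal; unfold G, difference_quotient.
  destruct (Ceq_dec x w); [contradiction|]; fold b.
  replace (1 + - Cconj b * f x)%C with (1 - Cconj b * f x)%C by ring.
  field; split; assumption. }
assert (G1 : Cmod (G z) <= 1).
{ apply Rnot_lt_le; intros L.
  set (eta := Cmod (G z) - 1).
  assert (Heta : 0 < eta) by (unfold eta; lra).
  assert (Z0 := Cmod_ge_0 z); assert (W0 := Cmod_ge_0 w).
  (* rho is so close to 1 that the bound on the circle stays below 1 + eta *)
  set (m := Rmin eta 1 * (1 - Cmod w) / 4).
  assert (Hm0 : 0 < Rmin eta 1) by (apply Rmin_glb_lt; lra).
  assert (Hm1 : Rmin eta 1 <= 1) by apply Rmin_r.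
  assert (Hm2 : Rmin eta 1 <= eta) by apply Rmin_l.
  assert (Hm : 0 < m).
  { unfold m; apply Rdiv_lt_0_compat; [apply Rmult_lt_0_compat|]; lra. }
  assert (Hmw : m <= (1 - Cmod w) / 4).
  { unfold m; apply Rmult_le_compat_r; [lra|].
    rewrite <- (Rmult_1_l (1 - Cmod w)) at 2; apply Rmult_le_compat_r; lra. }
  assert (Hme : m <= eta * (1 - Cmod w) / 4).
  { unfold m; apply Rmult_le_compat_r; [lra|]; apply Rmult_le_compat_r; lra. }
  set (rho := Rmax (Cmod z) (1 - m / 2)).
  assert (R1 : rho < 1) by (apply Rmax_lub_lt; lra).
  assert (R2 : Cmod z <= rho) by apply Rmax_l.
  assert (R3 : 1 - m / 2 <= rho) by apply Rmax_r.
  assert (R4 : 0 < rho - Cmod w) by lra.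
  assert (R5 : 0 <= (1 - rho ^ 2) / (rho - Cmod w)).
  { apply Rdiv_le_0_compat; [|exact R4].
    replace (1 - rho ^ 2) with ((1 - rho) * (1 + rho)) by ring.
    apply Rmult_le_pos; lra. }
  assert (Q : Cmod (G z) <= 1 + (1 - rho ^ 2) / (rho - Cmod w)).
  { apply (maximum_principle G rho); try lra.
    - intros x Hx; apply GJ; lra.
    - intros x Hx.
      assert (Hx1 : Cmod x < 1) by lra.
      assert (D := Cmod_dist x w); apply Rabs_le_between in D; rewrite Hx in D.
      assert (Nx : x <> w) by (intros ->; lra).
      assert (E := GE x Hx1 Nx).
      assert (P1 : Cmod (f x - b)%C <= Cmod (1 - Cconj b * f x)%C).
      { apply Cmod_le_of_sqr; [apply Cmod_ge_0|].
        rewrite Cmod_1_minus_conj_mult.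
        assert (0 < (1 - Cmod (f x) ^ 2) * (1 - Cmod b ^ 2)); [|lra].
        apply Rmult_lt_0_compat; apply Cmod_sqr_lt_1; [now apply HS | exact Hb]. }
      assert (P2 : Cmod (1 - Cconj w * x)%C <= (1 - rho ^ 2) + Cmod (x - w)%C).
      { replace (1 - Cconj w * x)%C
          with (RtoC (1 - rho ^ 2) + x * Cconj (x - w))%C.
          apply Rle_trans with (1 := Cmod_triangle _ _).
          rewrite Cmod_mult, Cmod_conj, Cmod_R, Hx.
          rewrite Rabs_pos_eq.
            assert (rho * Cmod (x - w)%C <= 1 * Cmod (x - w)%C); [|lra].
            apply Rmult_le_compat_r; [apply Cmod_ge_0 | lra].
          replace (1 - rho ^ 2) with ((1 - rho) * (1 + rho)) by ring.
          apply Rmult_le_pos; lra.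
        rewrite <- Hx, RtoC_minus, Cmod2_conj, Cminus_conj; ring. }
      assert (N1 : 0 < Cmod (1 - Cconj b * f x)%C).
      { apply Cmod_gt_0, one_minus_conj_mult_neq_0; [now apply HS | exact Hb]. }
      assert (N2 : 0 < Cmod (x - w)%C) by lra.
      apply Rmult_le_reg_r with (Cmod (x - w)%C * Cmod (1 - Cconj b * f x)%C).
        now apply Rmult_lt_0_compat.
      rewrite E, Rmult_comm, <- Rmult_assoc.
      apply Rmult_le_compat; try apply Cmod_ge_0; [|exact P1].
      apply Rle_trans with (1 := P2).
      assert (1 - rho ^ 2 <= (1 - rho ^ 2) / (rho - Cmod w) * Cmod (x - w)%C); [|lra].
      replace (1 - rho ^ 2) with ((1 - rho ^ 2) / (rho - Cmod w) * (rho - Cmod w)) at 1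
        by (field; lra).
      apply Rmult_le_compat_l; lra. }
  assert (Q' : eta * (rho - Cmod w) <= 1 - rho ^ 2).
  { replace (1 - rho ^ 2) with ((1 - rho ^ 2) / (rho - Cmod w) * (rho - Cmod w))
      by (field; lra).
    apply Rmult_le_compat_r; [lra | unfold eta; lra]. }
  assert (eta * ((1 - Cmod w) / 2) <= eta * (rho - Cmod w)).
    apply Rmult_le_compat_l; lra.
  assert (1 - rho ^ 2 <= m).
  { replace (1 - rho ^ 2) with ((1 - rho) * (1 + rho)) by ring.
    apply Rle_trans with ((m / 2) * 2); [|lra].
    apply Rmult_le_compat; lra. }
  lra. }
assert (E := GE z Hz Nzw).
assert (Le : Cmod (f z - b)%C * Cmod (1 - Cconj w * z)%C
    <= Cmod (z - w)%C * Cmod (1 - Cconj b * f z)%C).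
{ rewrite <- E; rewrite <- (Rmult_1_l (Cmod (z - w)%C * _)) at 2.
  apply Rmult_le_compat_r; [|exact G1].
  apply Rmult_le_pos; apply Cmod_ge_0. }
assert (Le2 : (Cmod (f z - b)%C * Cmod (1 - Cconj w * z)%C) ^ 2
    <= (Cmod (z - w)%C * Cmod (1 - Cconj b * f z)%C) ^ 2).
{ apply pow_incr; split; [|exact Le]; apply Rmult_le_pos; apply Cmod_ge_0. }
rewrite !Rpow_mult_distr, !Cmod_1_minus_conj_mult in Le2.
unfold pdist2; fold b.
assert (A1 := Cmod_sqr_lt_1 _ Hz); assert (A2 := Cmod_sqr_lt_1 _ Hw).
assert (A3 := Cmod_sqr_lt_1 _ (HS z Hz)); assert (A4 := Cmod_sqr_lt_1 _ Hb).
assert (P := Rmult_lt_0_compat _ _ A1 A2); assert (P' := Rmult_lt_0_compat _ _ A3 A4).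
apply Rmult_le_reg_r with (1 := Rmult_lt_0_compat _ _ P P').
match goal with |- ?l <= ?r =>
  replace l with (Cmod (f z - b)%C ^ 2 * ((1 - Cmod z ^ 2) * (1 - Cmod w ^ 2)))
    by (field; split; lra);
  replace r with (Cmod (z - w)%C ^ 2 * ((1 - Cmod (f z) ^ 2) * (1 - Cmod b ^ 2)))
    by (field; split; lra)
end.
lra.
Qed.

(** * Analyticity of the Moebius maps *)

Lemma is_pseries_const (c h : C) :
  is_pseries (fun n => match n with O => c | S _ => RtoC 0 end) h c.
Proof.
unfold is_pseries, is_series.
apply filterlim_ext with (fun _ : nat => c); [|apply filterlim_const].
intros n; induction n as [|n IH].
  rewrite sum_O; change (c = 1 * c)%C; ring.
rewrite sum_Sn, <- IH.
change (c = c + pow_n h (S n) * 0)%C; ring.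
Qed.

Lemma is_pseries_geom (q h : C) : Cmod (q * h)%C < 1 ->
  is_pseries (fun n => (q ^ n)%C) h (/ (1 - q * h))%C.
Proof.
intros Hx; set (x := (q * h)%C) in *.
assert (Nx : (1 - x)%C <> 0%C).
{ intros E; apply Cminus_eq_0 in E; rewrite <- E, Cmod_1 in Hx; lra. }
assert (Px : 0 < Cmod (1 - x)%C) by now apply Cmod_gt_0.
assert (GS : forall n, sum_n (fun k => scal (pow_n h k) (q ^ k)%C) n
  = ((1 - x ^ S n) / (1 - x))%C).
{ induction n as [|n IH].
  - rewrite sum_O; change (1 * 1 = (1 - x * 1) / (1 - x))%C; field; exact Nx.
  - rewrite sum_Sn, IH.
    change ((1 - x ^ S n) / (1 - x) + h ^ S n * q ^ S n
      = (1 - x * x ^ S n) / (1 - x))%C.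
    replace (h ^ S n * q ^ S n)%C with (x ^ S n)%C
      by (unfold x; rewrite Cpow_mult_l; ring).
    field; exact Nx. }
apply (proj2 (filterlim_locally_ball_norm (U := C_NormedModule) _ _)).
intros e.
assert (Pe : 0 < e * Cmod (1 - x)%C).
  apply Rmult_lt_0_compat; [apply cond_pos | exact Px].
destruct (pow_lt_1_zero (Cmod x)
  ltac:(rewrite Rabs_pos_eq; [exact Hx | apply Cmod_ge_0]) _ Pe) as [N HN].
exists N; intros n Hn.
change (Cmod (sum_n (fun k => scal (pow_n h k) (q ^ k)%C) n - / (1 - x))%C < e).
rewrite GS.
replace ((1 - x ^ S n) / (1 - x) - / (1 - x))%C
  with (- (x ^ S n / (1 - x)))%C by (field; exact Nx).
rewrite Cmod_opp, Cmod_div, Cmod_pow by exact Nx.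
apply Rmult_lt_reg_r with (1 := Px).
unfold Rdiv; rewrite Rmult_assoc, Rinv_l, Rmult_1_r by lra.
assert (Q := HN (S n) ltac:(lia)).
rewrite Rabs_pos_eq in Q; [exact Q | apply pow_le, Cmod_ge_0].
Qed.

Lemma analytic_id : analytic (fun z => z).
Proof.
intros z0; eexists _, 1; split; [lra|]; intros z _.
set (h := (z - z0)%C).
replace (disk_val z) with (plus (disk_val z0) (scal h (RtoC 1 : C_NormedModule)))
  by (unfold h; change (z0 + (z - z0) * 1 = z)%C; ring).
apply (is_pseries_plus (V := C_NormedModule)).
  apply is_pseries_const.
apply (is_pseries_incr_1 (V := C_NormedModule)), is_pseries_const.
Qed.

(** With c = 1 - conj(b) w0 and q = conj(b) / c, the map at w0 + h equals
    (w0 - b) / c + ((1 - |b|^2) / c^2) * h / (1 - q h), a shifted geometric series. *)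
Lemma analytic_mobius (b : C) : Cmod b < 1 ->
  analytic (fun w => (w - b) / (1 - Cconj b * w))%C.
Proof.
intros Hb w0; destruct w0 as [w0 Hw0]; simpl.
set (c := (1 - Cconj b * w0)%C).
assert (Nc : c <> 0%C) by now apply one_minus_conj_mult_neq_0.
set (q := (Cconj b / c)%C).
assert (Hq : 0 <= Cmod q) by apply Cmod_ge_0.
eexists _, (/ (Cmod q + 1)); split; [apply Rinv_0_lt_compat; lra|].
intros [w Hw]; simpl; intros Hh; set (h := (w - w0)%C) in *.
assert (Hqh : Cmod (q * h)%C < 1).
{ rewrite Cmod_mult.
  apply Rle_lt_trans with (Cmod q * / (Cmod q + 1)).
    apply Rmult_le_compat_l; lra.
  apply Rmult_lt_reg_r with (Cmod q + 1); [lra|].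
  rewrite Rmult_assoc, Rinv_l; lra. }
assert (N1 : (1 - q * h)%C <> 0%C).
{ intros E; apply Cminus_eq_0 in E; rewrite <- E, Cmod_1 in Hqh; lra. }
assert (N2 : (1 - Cconj b * w)%C <> 0%C) by now apply one_minus_conj_mult_neq_0.
replace ((w - b) / (1 - Cconj b * w))%C
  with (plus ((w0 - b) / c)%C
    (scal ((1 - Cconj b * b) / (c * c))%C
      (scal h ((/ (1 - q * h))%C : C_NormedModule)))).
- apply (is_pseries_plus (V := C_NormedModule)).
    apply is_pseries_const.
  apply (is_pseries_scal (V := C_NormedModule)); [apply Cmult_comm|].
  apply (is_pseries_incr_1 (V := C_NormedModule)), is_pseries_geom, Hqh.
- change ((w0 - b) / c + (1 - Cconj b * b) / (c * c) * (h * / (1 - q * h))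
    = (w - b) / (1 - Cconj b * w))%C.
  replace (1 - q * h)%C with ((1 - Cconj b * w) / c)%C
    by (unfold q, h; field_simplify_eq; [unfold c; ring | exact Nc]).
  unfold h; field_simplify_eq; [unfold c; ring | split; assumption].
Qed.

(** * Recurrence forces iterates close to the identity *)

Lemma identity_mem (A : function_space) :
  A = disk_algebra \/ A = H_infty -> A (fun z => disk_val z).
Proof.
intros [-> | ->]; simpl; split; try exact analytic_id.
- exists (fun z => z); split; [|reflexivity].
  intros z _; unfold within; intros P [d HP]; exists d; intros y Hy _; now apply HP.
- exists 1; intros [z Hz]; simpl; lra.
Qed.

Lemma iter_composition_operator (A : function_space) (phi : disk -> disk)
  (H : induces_composition A phi) (k : nat) (f : fs_NormedModule A) (z : disk) :
  fs_fun A (Nat.iter k (composition_operator A phi H) f) z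
  = fs_fun A f (Nat.iter k phi z).
Proof.
revert z; induction k as [|k IH]; intros z; [reflexivity|].
rewrite (Nat.iter_succ_r k _ phi z); exact (IH (phi z)).
Qed.

(** Take f within e/2 of the identity function J such that f o phi^k is also within e/2
    of J.  Evaluating f - J at phi^k z shows that f o phi^k is within e/2 of phi^k, so
    phi^k is within e of J. *)
Lemma recurrent_iterates_near_id (A : function_space) (phi : disk -> disk)
  (H : induces_composition A phi) :
  A (fun z => disk_val z) -> recurrent (composition_operator A phi H) ->
  forall e, 0 < e -> exists k : nat, (0 < k)%nat /\
    forall z : disk, Cmod (Nat.iter k phi z - z)%C < e.
Proof.
intros Hid Hrec e He.
set (J := exist (fun f => fs_mem A f) _ Hid : fs_NormedModule A).
destruct (Hrec (fun f => fs_norm A (minus f J) < e / 2)) as [k [Hk [f [H1 H2]]]].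
- intros f Hf.
  assert (Pd : 0 < e / 2 - fs_norm A (minus f J)) by lra.
  exists (mkposreal _ Pd); intros g Hg.
  assert (T' := fs_norm_plus A (minus f J) (minus g f)).
  assert (E : minus g J = plus (minus f J) (minus g f)).
  { apply fs_eq; intros z.
    change (fs_fun A g z + -1 * fs_fun A J z
      = (fs_fun A f z + -1 * fs_fun A J z) + (fs_fun A g z + -1 * fs_fun A f z))%C; ring. }
  rewrite E; apply Rle_lt_trans with (1 := T').
  change (fs_norm A (minus g f) < e / 2 - fs_norm A (minus f J)) in Hg; lra.
- exists J; apply (fs_ball_center A J (mkposreal (e / 2) ltac:(lra))).
- exists k; split; [exact Hk|]; intros z.
  assert (B1 := fs_norm_ub A (minus f J) (Nat.iter k phi z)).
  assert (B2 := fs_norm_ub A (minus (Nat.iter k (composition_operator A phi H) f) J) z).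
  change (Cmod (fs_fun A f (Nat.iter k phi z) + -1 * Nat.iter k phi z)%C
    <= fs_norm A (minus f J)) in B1.
  change (Cmod (fs_fun A (Nat.iter k (composition_operator A phi H) f) z + -1 * z)%C
    <= fs_norm A (minus (Nat.iter k (composition_operator A phi H) f) J)) in B2.
  rewrite iter_composition_operator in B2.
  replace (Nat.iter k phi z - z)%C
    with (- (fs_fun A f (Nat.iter k phi z) + -1 * Nat.iter k phi z)
      + (fs_fun A f (Nat.iter k phi z) + -1 * z))%C by ring.
  apply Rle_lt_trans with (1 := Cmod_triangle _ _); rewrite Cmod_opp; lra.
Qed.

Definition returning (phi : disk -> disk) (k : nat -> nat) : Prop :=
  (forall n, (0 < k n)%nat) /\
  forall z : disk, is_lim_seq (fun n => Cmod (Nat.iter (k n) phi z - z)%C) 0.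

Lemma returning_exists (phi : disk -> disk) :
  (forall e, 0 < e -> exists k : nat, (0 < k)%nat /\
    forall z : disk, Cmod (Nat.iter k phi z - z)%C < e) ->
  exists k, returning phi k.
Proof.
intros H.
assert (P : forall n : nat, 0 < (/ 2) ^ n) by (intros n; apply pow_lt; lra).
exists (fun n => proj1_sig (constructive_indefinite_description _ (H _ (P n)))).
split.
- intros n; now destruct (constructive_indefinite_description _ (H _ (P n))) as [k [K1 K2]].
- intros z; apply is_lim_seq_le_le with (fun _ => 0) (fun n => (/ 2) ^ n).
  + intros n; destruct (constructive_indefinite_description _ (H _ (P n))) as [k [K1 K2]].
    simpl; split; [apply Cmod_ge_0 | apply Rlt_le, K2].
  + apply is_lim_seq_const.
  + apply is_lim_seq_geom; rewrite Rabs_pos_eq; lra.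
Qed.

Lemma is_lim_seq_dominated (u : nat -> R) (l : R) (d : nat -> R) :
  (forall n, Rabs (u n - l) <= d n) -> is_lim_seq d 0 -> is_lim_seq u l.
Proof.
intros H Hd.
apply is_lim_seq_le_le with (fun n => l - d n) (fun n => l + d n).
- intros n; specialize (H n); apply Rabs_le_between in H; lra.
- replace l with (l - 0) at 1 by ring.
  now apply is_lim_seq_minus'; [apply is_lim_seq_const|].
- replace l with (l + 0) at 1 by ring.
  now apply is_lim_seq_plus'; [apply is_lim_seq_const|].
Qed.

Lemma returning_dist phi k (z w : disk) : returning phi k ->
  is_lim_seq (fun n => Cmod (Nat.iter (k n) phi z - Nat.iter (k n) phi w)%C)
    (Cmod (z - w)%C).
Proof.
intros [_ H]; eapply is_lim_seq_dominated.
2: { replace 0 with (0 + 0) by ring; apply is_lim_seq_plus'; [apply (H z) | apply (H w)]. }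
intros n; cbv beta.
apply Rle_trans with (1 := Cmod_dist _ _).
rewrite <- (Cmod_opp (Nat.iter (k n) phi w - w)%C).
match goal with |- Cmod ?x <= _ =>
  replace x with ((Nat.iter (k n) phi z - z) + - (Nat.iter (k n) phi w - w))%C by ring
end.
apply Cmod_triangle.
Qed.

Lemma returning_dist_const phi k (z : disk) (c : C) : returning phi k ->
  is_lim_seq (fun n => Cmod (Nat.iter (k n) phi z - c)%C) (Cmod (z - c)%C).
Proof.
intros [_ H]; eapply is_lim_seq_dominated; [|exact (H z)].
intros n; cbv beta; apply Rle_trans with (1 := Cmod_dist _ _); apply Req_le; f_equal; ring.
Qed.

Lemma returning_Cmod phi k (z : disk) : returning phi k ->
  is_lim_seq (fun n => Cmod (Nat.iter (k n) phi z)) (Cmod z).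
Proof.
intros H; generalize (returning_dist_const phi k z 0%C H).
replace (z - 0)%C with (disk_val z) by ring.
apply is_lim_seq_ext; intros n; f_equal; ring.
Qed.

Lemma pdist2_denom_neq_0 (z w : disk) : (1 - Cmod z ^ 2) * (1 - Cmod w ^ 2) <> 0.
Proof.
assert (H1 := Cmod_sqr_lt_1 _ (proj2_sig z)).
assert (H2 := Cmod_sqr_lt_1 _ (proj2_sig w)).
apply Rgt_not_eq, Rmult_lt_0_compat; assumption.
Qed.

Lemma is_lim_seq_sqr (u : nat -> R) (l : R) :
  is_lim_seq u l -> is_lim_seq (fun n => u n ^ 2) (l ^ 2).
Proof.
intros H; replace (l ^ 2) with (l * l) by ring.
apply is_lim_seq_ext with (fun n => u n * u n); [intros; ring|].
now apply is_lim_seq_mult'.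
Qed.

Lemma returning_pdist2 phi k (z w : disk) : returning phi k ->
  is_lim_seq (fun n => pdist2 (Nat.iter (k n) phi z) (Nat.iter (k n) phi w))
    (pdist2 z w).
Proof.
intros H; unfold pdist2.
apply is_lim_seq_div'; [| |apply pdist2_denom_neq_0].
- now apply is_lim_seq_sqr, returning_dist.
- apply is_lim_seq_mult'; (apply is_lim_seq_minus'; [apply is_lim_seq_const|]);
    now apply is_lim_seq_sqr, returning_Cmod.
Qed.

(** Schwarz-Pick gives d (phi^m z) (phi^m w) <= d (phi z) (phi w) <= d z w for all
    m >= 1, with d = [pdist2]; along returning times the left side tends to d z w. *)
Lemma returning_pdist2_eq (phi : disk -> disk) (k : nat -> nat) :
  analytic (fun z => phi z) -> returning phi k ->
  forall z w : disk, pdist2 (phi z) (phi w) = pdist2 z w.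
Proof.
intros Ha Hk.
assert (SP : forall z w : disk, pdist2 (phi z) (phi w) <= pdist2 z w).
{ intros z w.
  assert (Q := schwarz_pick (extend (fun z => phi z))
    (fun z => analytic_cubic_jet _ z Ha)).
  specialize (Q (extend_self_map phi) z w (proj2_sig z) (proj2_sig w)).
  now rewrite !extend_disk in Q. }
assert (It : forall z w m, pdist2 (Nat.iter m phi z) (Nat.iter m phi w) <= pdist2 z w).
{ intros z w m; induction m as [|m IH]; [apply Rle_refl|].
  apply Rle_trans with (2 := IH), SP. }
intros z w; apply Rle_antisym; [apply SP|].
apply (is_lim_seq_le _ (fun _ => pdist2 (phi z) (phi w)) (pdist2 z w)
  (pdist2 (phi z) (phi w))) with (2 := returning_pdist2 phi k z w Hk).
- intros n; destruct (k n) as [|m] eqn:E.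
    generalize (proj1 Hk n); lia.
  rewrite !(Nat.iter_succ_r m _ phi); apply It.
- apply is_lim_seq_const.
Qed.

(** * Isometries of the disk are Moebius maps *)

(** Complex conjugation has derivative 1 along the real axis and -1 along the imaginary
    axis. *)
Lemma conj_has_no_jet (g : C -> C) : has_jet g 0%C -> ~ near0 (fun h => g h = Cconj h).
Proof.
intros [a [b [c J]]] Hc.
assert (Ea : a = 0%C).
{ rewrite <- (jet_value _ _ _ _ _ J).
  destruct Hc as [r [Hr Hc]]; rewrite Hc by (rewrite Cmod_0; exact Hr).
  unfold Cconj; simpl; now rewrite Ropp_0. }
destruct J as [E [HE J]].
assert (B : bounded_near0 (fun h => c + h * E h)%C) by bnd0.
destruct B as [K HK].
destruct (near0_and _ _ HK (near0_and _ _ J Hc)) as [r [Hr H]].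
set (m := Rmax K 1); assert (Hm : 1 <= m) by apply Rmax_r.
set (t := Rmin (r / 2) (/ (2 * m))).
assert (Ht : 0 < t).
{ apply Rmin_glb_lt; [lra|]; apply Rinv_0_lt_compat; lra. }
assert (Htr : t < r) by (apply Rle_lt_trans with (1 := Rmin_l _ _); lra).
assert (Htm : t * m <= / 2).
{ apply Rle_trans with (/ (2 * m) * m).
    apply Rmult_le_compat_r; [lra | apply Rmin_r].
  apply Req_le; field; lra. }
assert (Ct : Cmod t = t) by (rewrite Cmod_R; apply Rabs_pos_eq; lra).
assert (Nt : RtoC t <> 0%C) by (apply Cmod_gt_0; lra).
destruct (H t ltac:(lra)) as [B1 [J1 C1]].
destruct (H (Ci * t)%C ltac:(rewrite Cmod_mult, Cmod_Ci; lra)) as [B2 [J2 C2]].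
rewrite Cplus_0_l, C1, Ea in J1; rewrite Cplus_0_l, C2, Ea in J2.
replace (Cconj t) with (RtoC t) in J1
  by (unfold Cconj, RtoC; simpl; now rewrite Ropp_0).
replace (Cconj (Ci * t)) with (- (Ci * t))%C in J2
  by (unfold Ci; apply injective_projections; simpl; ring).
set (s1 := (c + t * E t)%C) in *; set (s2 := (c + Ci * t * E (Ci * t))%C) in *.
assert (K1 : (RtoC 1 = b + t * s1)%C).
{ apply (f_equal (fun x => x / t)%C) in J1.
  replace (t / t)%C with (RtoC 1) in J1 by (field; exact Nt).
  rewrite J1; unfold s1; field; exact Nt. }
assert (NCi : Ci <> 0%C) by (apply Cmod_gt_0; rewrite Cmod_Ci; lra).
assert (K2 : (- (1) = b + Ci * t * s2)%C).
{ apply (f_equal (fun x => x / (Ci * t))%C) in J2.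
  replace (- (Ci * t) / (Ci * t))%C with (- (1))%C in J2 by (field; split; assumption).
  rewrite J2; unfold s2; field; split; assumption. }
assert (K3 : (RtoC 2 = t * (s1 + - (Ci * s2)))%C).
{ replace (RtoC 2) with (1 - - (1))%C by (unfold RtoC; apply injective_projections; simpl; ring).
  rewrite K2, K1 at 1; ring. }
apply (f_equal Cmod) in K3; rewrite Cmod_mult, Ct, Cmod_R, Rabs_pos_eq in K3 by lra.
assert (K4 := Cmod_triangle s1 (- (Ci * s2))%C).
rewrite Cmod_opp, Cmod_mult, Cmod_Ci in K4.
assert (Km : K <= m) by apply Rmax_l.
assert (t * Cmod (s1 + - (Ci * s2))%C <= t * (2 * m)).
{ apply Rmult_le_compat_l; lra. }
lra.
Qed.

(** Compose F with a rotation so that 1/2 is fixed.  Preservation of inner products then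
    determines the real part of the image, and its imaginary part up to a sign that does
    not depend on the point; the expansion at 0 excludes complex conjugation. *)
Lemma euclidean_isometry_is_rotation (F : C -> C) :
  (forall z, Cmod z < 1 -> Cmod (F z) = Cmod z) ->
  (forall z w, Cmod z < 1 -> Cmod w < 1 -> Cmod (F z - F w)%C = Cmod (z - w)%C) ->
  has_jet F 0%C ->
  exists lam : C, Cmod lam = 1 /\ forall z, Cmod z < 1 -> (F z = lam * z)%C.
Proof.
intros H0 H1 HJ.
assert (Hh : Cmod (/ 2)%C < 1).
{ rewrite <- RtoC_inv, Cmod_R, Rabs_pos_eq; lra. }
set (lam := (2 * F (/ 2))%C).
assert (Hl : Cmod lam = 1).
{ unfold lam; rewrite Cmod_mult, H0 by exact Hh.
  rewrite <- RtoC_inv, !Cmod_R, !Rabs_pos_eq by lra; field. }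
assert (Ll : (lam * Cconj lam = 1)%C).
{ rewrite <- Cmod2_conj, Hl; unfold RtoC; apply injective_projections; simpl; ring. }
exists lam; split; [exact Hl|].
set (G := fun z => (0 + Cconj lam * F z)%C).
assert (G0 : forall z, Cmod z < 1 -> Cmod (G z) = Cmod z).
{ intros z Hz; unfold G; rewrite Cplus_0_l, Cmod_mult, Cmod_conj, Hl, H0 by exact Hz; ring. }
assert (G1 : forall z w, Cmod z < 1 -> Cmod w < 1 -> Cmod (G z - G w)%C = Cmod (z - w)%C).
{ intros z w Hz Hw; rewrite <- (H1 z w) by assumption; unfold G.
  replace (0 + Cconj lam * F z - (0 + Cconj lam * F w))%C
    with (Cconj lam * (F z - F w))%C by ring.
  rewrite Cmod_mult, Cmod_conj, Hl; ring. }
assert (Gh : G (/ 2)%C = (/ 2)%C).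
{ unfold G; replace (F (/ 2)%C) with (lam / 2)%C by (unfold lam; field).
  replace (0 + Cconj lam * (lam / 2))%C with (lam * Cconj lam / 2)%C by (field).
  rewrite Ll; field. }
(* an isometry that fixes 0 preserves inner products, by polarization *)
assert (Pol : forall z w, Cmod z < 1 -> Cmod w < 1 -> dot (G z) (G w) = dot z w).
{ intros z w Hz Hw.
  assert (E := G1 z w Hz Hw); apply (f_equal (fun x => x ^ 2)) in E.
  unfold Cminus in E; rewrite !Cmod_sqr_plus, !Cmod_opp, !G0 in E by assumption.
  assert (N : forall x y, dot x (- y)%C = - dot x y).
  { intros [] []; unfold dot; simpl; ring. }
  rewrite !N in E; lra. }
assert (ReG : forall z, Cmod z < 1 -> Re (G z) = Re z).
{ intros z Hz; assert (E := Pol z (/ 2)%C Hz Hh); rewrite Gh in E.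
  assert (D : forall x, dot x (/ 2)%C = Re x / 2).
  { intros []; rewrite <- RtoC_inv by lra; unfold dot; simpl; field. }
  rewrite !D in E; lra. }
set (i2 := (Ci * / 2)%C).
assert (Hi : Cmod i2 < 1).
{ unfold i2; rewrite Cmod_mult, Cmod_Ci, Rmult_1_l; exact Hh. }
assert (Ri : Re i2 = 0).
{ unfold i2; rewrite <- RtoC_inv by lra; simpl; ring. }
assert (Ii : Im i2 = / 2).
{ unfold i2; rewrite <- RtoC_inv by lra; simpl; ring. }
assert (ImI : Im (G i2) ^ 2 = (/ 2) ^ 2).
{ assert (E := G0 i2 Hi); apply (f_equal (fun x => x ^ 2)) in E.
  rewrite !Cmod2_alt, ReG, Ri, Ii in E by exact Hi; lra. }
assert (ImG : forall z, Cmod z < 1 -> Im (G z) * Im (G i2) = Im z * / 2).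
{ intros z Hz; assert (E := Pol z i2 Hz Hi); unfold dot in E.
  rewrite !ReG, Ri, Ii in E by assumption; lra. }
destruct (Rle_lt_dec 0 (Im (G i2))) as [S|S].
- assert (V : Im (G i2) = / 2).
  { apply Rsqr_inj; [exact S | lra |]; now rewrite !Rsqr_pow2. }
  intros z Hz; assert (E : G z = z).
  { rewrite (surjective_pairing z) at 2; rewrite (surjective_pairing (G z)); f_equal.
      exact (ReG z Hz).
    assert (E := ImG z Hz); rewrite V in E; unfold Im in E; lra. }
  replace (F z) with ((lam * Cconj lam) * F z)%C by (rewrite Ll; ring).
  rewrite <- E at 2; unfold G; ring.
- exfalso; apply (conj_has_no_jet G).
    now apply has_jet_affine.
  exists 1; split; [lra|]; intros z Hz.
  assert (V : Im (G i2) = - / 2).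
  { apply Ropp_eq_reg; rewrite Ropp_involutive; apply Rsqr_inj; [lra | lra |].
    rewrite <- Rsqr_neg, !Rsqr_pow2; exact ImI. }
  rewrite (surjective_pairing (G z)); unfold Cconj; f_equal.
    exact (ReG z Hz).
  assert (E := ImG z Hz); rewrite V in E; unfold Im in E; lra.
Qed.

Lemma Cmod_mobius_sqr (b x : C) : Cmod b < 1 -> Cmod x < 1 ->
  1 - Cmod ((x - b) / (1 - Cconj b * x))%C ^ 2
  = (1 - Cmod b ^ 2) * (1 - Cmod x ^ 2) / Cmod (1 - Cconj b * x)%C ^ 2.
Proof.
intros Hb Hx; assert (N := one_minus_conj_mult_neq_0 x b Hx Hb).
assert (P := proj1 (Cmod_gt_0 _) N).
rewrite Cmod_div by exact N.
assert (I := Cmod_1_minus_conj_mult x b).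
set (D := Cmod (1 - Cconj b * x)%C) in *.
replace (1 - (Cmod (x - b)%C / D) ^ 2) with ((D ^ 2 - Cmod (x - b)%C ^ 2) / D ^ 2)
  by (field; lra).
f_equal; rewrite I; ring.
Qed.

Lemma mobius_disk (b x : C) : Cmod b < 1 -> Cmod x < 1 ->
  Cmod ((x - b) / (1 - Cconj b * x))%C < 1.
Proof.
intros Hb Hx; assert (E := Cmod_mobius_sqr b x Hb Hx).
assert (N := one_minus_conj_mult_neq_0 x b Hx Hb).
assert (P := proj1 (Cmod_gt_0 _) N).
assert (0 < (1 - Cmod b ^ 2) * (1 - Cmod x ^ 2) / Cmod (1 - Cconj b * x)%C ^ 2).
{ apply Rdiv_lt_0_compat; [|now apply pow_lt].
  apply Rmult_lt_0_compat; now apply Cmod_sqr_lt_1. }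
apply Rnot_le_lt; intros L.
assert (1 ^ 2 <= Cmod ((x - b) / (1 - Cconj b * x))%C ^ 2) by (apply pow_incr; lra).
lra.
Qed.

Lemma pdist2_mobius (b x y : C) : Cmod b < 1 -> Cmod x < 1 -> Cmod y < 1 ->
  pdist2 ((x - b) / (1 - Cconj b * x))%C ((y - b) / (1 - Cconj b * y))%C = pdist2 x y.
Proof.
intros Hb Hx Hy; unfold pdist2; rewrite !Cmod_mobius_sqr by assumption.
assert (Nx := one_minus_conj_mult_neq_0 x b Hx Hb).
assert (Ny := one_minus_conj_mult_neq_0 y b Hy Hb).
replace ((x - b) / (1 - Cconj b * x) - (y - b) / (1 - Cconj b * y))%C
  with ((1 - b * Cconj b) * (x - y) / ((1 - Cconj b * x) * (1 - Cconj b * y)))%C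
  by (field; split; assumption).
rewrite Cmod_div by now apply Cmult_neq_0.
rewrite !Cmod_mult, <- Cmod2_conj, <- RtoC_minus, Cmod_R.
assert (Pb := Cmod_sqr_lt_1 _ Hb); rewrite (Rabs_pos_eq (1 - Cmod b ^ 2)) by lra.
assert (Px := Cmod_sqr_lt_1 _ Hx); assert (Py := Cmod_sqr_lt_1 _ Hy).
apply Cmod_gt_0 in Nx; apply Cmod_gt_0 in Ny.
field; repeat split; lra.
Qed.

Lemma disk_eq (z w : disk) : disk_val z = disk_val w -> z = w.
Proof.
destruct z as [z Hz], w as [w Hw]; simpl; intros ->; f_equal; apply proof_irrelevance.
Qed.

Lemma pdist2_0 x : pdist2 x 0%C = Cmod x ^ 2 / (1 - Cmod x ^ 2).
Proof.
unfold pdist2; replace (x - 0)%C with x by ring; rewrite Cmod_0; f_equal; ring.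
Qed.

(** Compose phi with the Moebius map that sends phi 0 to 0.  The result preserves
    [pdist2] and fixes 0, so it preserves moduli, hence Euclidean distances, hence is a
    rotation. *)
Lemma pdist2_isometry_is_mobius (phi : disk -> disk) :
  analytic (fun z => phi z) ->
  (forall z w : disk, pdist2 (phi z) (phi w) = pdist2 z w) ->
  exists b lam : C, Cmod b < 1 /\ Cmod lam = 1 /\
    forall z : disk, disk_val (phi z) = ((lam * z + b) / (1 + Cconj b * lam * z))%C.
Proof.
intros Ha Hi.
set (f := extend (fun z => phi z)); set (b := disk_val (phi disk0)).
assert (Hb : Cmod b < 1) by exact (proj2_sig (phi disk0)).
assert (f0 : f 0%C = b) by exact (extend_disk _ disk0).
assert (Hf : forall x, Cmod x < 1 -> Cmod (f x) < 1) by exact (extend_self_map phi).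
assert (If : forall x y, Cmod x < 1 -> Cmod y < 1 -> pdist2 (f x) (f y) = pdist2 x y).
{ intros x y Hx Hy; unfold f.
  change x with (disk_val (exist _ x Hx)); change y with (disk_val (exist _ y Hy)).
  rewrite !extend_disk; apply Hi. }
set (F := fun x => ((- b + 1 * f x) * / (1 + - Cconj b * f x))%C).
assert (FE : forall x, F x = ((f x - b) / (1 - Cconj b * f x))%C).
{ intros x; unfold F, Cdiv; f_equal; [|f_equal]; ring. }
assert (FS : forall x, Cmod x < 1 -> Cmod (F x) < 1).
{ intros x Hx; rewrite FE; apply mobius_disk; [exact Hb | now apply Hf]. }
assert (FI : forall x y, Cmod x < 1 -> Cmod y < 1 -> pdist2 (F x) (F y) = pdist2 x y).
{ intros x y Hx Hy; rewrite !FE, pdist2_mobius by auto; now apply If. }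
assert (C0 : Cmod 0%C < 1) by (rewrite Cmod_0; lra).
assert (F0 : F 0%C = 0%C).
{ unfold F; rewrite f0; replace (- b + 1 * b)%C with (RtoC 0) by ring; ring. }
assert (H0 : forall x, Cmod x < 1 -> Cmod (F x) = Cmod x).
{ intros x Hx; assert (E := FI x 0%C Hx C0); rewrite F0, !pdist2_0 in E.
  assert (P1 := Cmod_sqr_lt_1 _ Hx); assert (P2 := Cmod_sqr_lt_1 _ (FS x Hx)).
  apply (f_equal (fun r => r * ((1 - Cmod x ^ 2) * (1 - Cmod (F x) ^ 2)))) in E.
  field_simplify in E; [|lra|lra].
  apply Rsqr_inj; [apply Cmod_ge_0 | apply Cmod_ge_0 |].
  rewrite !Rsqr_pow2; lra. }
assert (H1 : forall x y, Cmod x < 1 -> Cmod y < 1 -> Cmod (F x - F y)%C = Cmod (x - y)%C).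
{ intros x y Hx Hy; assert (E := FI x y Hx Hy); unfold pdist2 in E.
  rewrite !H0 in E by assumption.
  assert (P1 := Cmod_sqr_lt_1 _ Hx); assert (P2 := Cmod_sqr_lt_1 _ Hy).
  apply Rsqr_inj; [apply Cmod_ge_0 | apply Cmod_ge_0 |].
  rewrite !Rsqr_pow2.
  apply Rmult_eq_reg_r in E; [exact E|].
  apply Rinv_neq_0_compat, Rgt_not_eq, Rmult_lt_0_compat; assumption. }
destruct (euclidean_isometry_is_rotation F H0 H1) as [lam [Hl HF]].
{ assert (Jf : has_jet f 0%C).
    now apply cubic_jet_has_jet, analytic_cubic_jet.
  apply has_jet_mult; [now apply has_jet_affine|].
  apply jet_inv; [now apply has_jet_affine|].
  replace (1 + - Cconj b * f 0)%C with (1 - Cconj b * f 0)%C by ring.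
  apply one_minus_conj_mult_neq_0; [now apply Hf | exact Hb]. }
exists b, lam; split; [exact Hb|]; split; [exact Hl|]; intros z.
assert (Hz := proj2_sig z : Cmod z < 1).
assert (E := HF z Hz); rewrite FE in E.
assert (N1 : (1 - Cconj b * f z)%C <> 0%C).
{ apply one_minus_conj_mult_neq_0; [now apply Hf | exact Hb]. }
assert (N2 : (1 + Cconj b * lam * z)%C <> 0%C).
{ replace (1 + Cconj b * lam * z)%C with (1 - Cconj b * (- (lam * z)))%C by ring.
  apply one_minus_conj_mult_neq_0; [|exact Hb].
  now rewrite Cmod_opp, Cmod_mult, Hl, Rmult_1_l. }
assert (E' : (f z - b = lam * z * (1 - Cconj b * f z))%C).
{ rewrite <- E; field; exact N1. }
assert (Fz : f z = disk_val (phi z)) by exact (extend_disk (fun x => phi x) z).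
rewrite <- Fz.
replace (lam * z + b)%C with (f z * (1 + Cconj b * lam * z))%C.
  field; exact N2.
replace (f z * (1 + Cconj b * lam * z))%C
  with (f z - b + b + Cconj b * lam * z * f z)%C by ring.
rewrite E'; ring.
Qed.

(** * Moebius self-maps of the disk *)

Lemma unimodular_conj (lam : C) : Cmod lam = 1 -> (lam * Cconj lam = 1)%C.
Proof.
intros Hlam; rewrite <- Cmod2_conj, Hlam; unfold RtoC; apply injective_projections; simpl; ring.
Qed.

Lemma mobius_denom_neq_0 (b lam z : C) :
  Cmod b < 1 -> Cmod lam = 1 -> Cmod z <= 1 -> (1 + Cconj b * lam * z)%C <> 0%C.
Proof.
intros Hb Hlam Hz E.
assert (E1 : (Cconj b * lam * z = - (1))%C).
{ replace (Cconj b * lam * z)%C with (1 + Cconj b * lam * z - 1)%C by ring.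
  rewrite E; ring. }
apply (f_equal Cmod) in E1.
rewrite !Cmod_mult, Cmod_conj, Hlam, Cmod_opp, Cmod_1 in E1.
assert (B0 := Cmod_ge_0 b); assert (Z0 := Cmod_ge_0 z).
assert (Cmod b * 1 * Cmod z <= Cmod b * 1 * 1) by (apply Rmult_le_compat_l; lra).
lra.
Qed.

Lemma mobius_inverse_disk (b lam : C) (w : disk) : Cmod b < 1 -> Cmod lam = 1 ->
  Cmod (Cconj lam * ((w - b) / (1 - Cconj b * w)))%C < 1.
Proof.
intros Hb Hlam; rewrite Cmod_mult, Cmod_conj, Hlam, Rmult_1_l.
apply mobius_disk; [exact Hb | exact (proj2_sig w)].
Qed.

Lemma mobius_conformal_automorphism (phi : disk -> disk) (b lam : C) :
  Cmod b < 1 -> Cmod lam = 1 ->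
  (forall z : disk, disk_val (phi z) = ((lam * z + b) / (1 + Cconj b * lam * z))%C) ->
  analytic (fun z => phi z) -> conformal_automorphism phi.
Proof.
intros Hb Hlam Hphi Ha; split; [exact Ha|].
assert (L := unimodular_conj lam Hlam).
exists (fun w => exist (fun x : C => Cmod x < 1) _ (mobius_inverse_disk b lam w Hb Hlam));
  simpl.
assert (Bb : (1 - Cconj b * b)%C <> 0%C) by now apply one_minus_conj_mult_neq_0.
repeat split.
- now apply (analytic_scal (Cconj lam)), analytic_mobius.
- intros z; apply disk_eq; simpl.
  assert (Hz := proj2_sig z : Cmod z < 1).
  assert (N := mobius_denom_neq_0 b lam z Hb Hlam (Rlt_le _ _ Hz)).
  assert (N' : (1 - Cconj b * phi z)%C <> 0%C).
  { apply one_minus_conj_mult_neq_0; [exact (proj2_sig (phi z)) | exact Hb]. }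
  rewrite Hphi in *.
  replace ((lam * z + b) / (1 + Cconj b * lam * z) - b)%C
    with ((1 - Cconj b * b) * lam * z / (1 + Cconj b * lam * z))%C by (field; exact N).
  replace (1 - Cconj b * ((lam * z + b) / (1 + Cconj b * lam * z)))%C
    with ((1 - Cconj b * b) / (1 + Cconj b * lam * z))%C by (field; exact N).
  transitivity (lam * Cconj lam * z)%C; [|rewrite L; ring].
  field; split; assumption.
- intros w; apply disk_eq; rewrite Hphi; simpl.
  assert (Hw := proj2_sig w : Cmod w < 1).
  assert (N := one_minus_conj_mult_neq_0 w b Hw Hb).
  replace (lam * (Cconj lam * ((w - b) / (1 - Cconj b * w))))%C
    with ((w - b) / (1 - Cconj b * w))%C
    by (rewrite Cmult_assoc, L; ring).
  replace (Cconj b * lam * (Cconj lam * ((w - b) / (1 - Cconj b * w))))%C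
    with (Cconj b * ((w - b) / (1 - Cconj b * w)))%C
    by (transitivity (Cconj b * (lam * Cconj lam) * ((w - b) / (1 - Cconj b * w)))%C;
        [rewrite L|]; ring).
  replace (1 + Cconj b * ((w - b) / (1 - Cconj b * w)))%C
    with ((1 - Cconj b * b) / (1 - Cconj b * w))%C by (field; exact N).
  field; split; assumption.
Qed.

(** * Moebius maps without fixed point in the disk *)

Lemma Csqrt_exists (z : C) : exists s : C, (s * s = z)%C.
Proof.
set (r := Cmod z); assert (Hr : 0 <= r) by apply Cmod_ge_0.
assert (Hs : (RtoC (sqrt r) * RtoC (sqrt r) = r)%C).
{ rewrite <- RtoC_mult, sqrt_sqrt by exact Hr; reflexivity. }
destruct (Ceq_dec (z + r)%C 0%C) as [E|N].
(* z = - r: the generic formula below would divide by 0 *)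
- exists (Ci * sqrt r)%C.
  replace (Ci * sqrt r * (Ci * sqrt r))%C with (Ci * Ci * (sqrt r * sqrt r))%C by ring.
  rewrite Hs; replace z with (z + r - r)%C by ring; rewrite E.
  unfold Ci; apply injective_projections; simpl; ring.
- exists (sqrt r * (z + r) / Cmod (z + r))%C.
  assert (P := proj1 (Cmod_gt_0 _) N).
  assert (NP : RtoC (Cmod (z + r)%C) <> 0%C).
  { intros E; apply RtoC_inj in E; lra. }
  replace (sqrt r * (z + r) / Cmod (z + r) * (sqrt r * (z + r) / Cmod (z + r)))%C
    with (sqrt r * sqrt r * ((z + r) * (z + r)) / (Cmod (z + r) * Cmod (z + r)))%C
    by (field; exact NP).
  rewrite Hs.
  assert (M : (RtoC (Cmod (z + r)%C) * RtoC (Cmod (z + r)%C) = (z + r) * (Cconj z + r))%C).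
  { transitivity (RtoC (Cmod (z + r)%C ^ 2)).
      rewrite <- RtoC_mult; f_equal; ring.
    rewrite Cmod2_conj, Cplus_conj; f_equal; f_equal.
    unfold Cconj, RtoC; simpl; now rewrite Ropp_0. }
  assert (Nz : (Cconj z + r)%C <> 0%C).
  { intros E; rewrite E, Cmult_0_r in M; exact (Cmult_neq_0 _ _ NP NP M). }
  rewrite M.
  assert (Z : (z * Cconj z = r * r)%C).
  { rewrite <- Cmod2_conj, <- RtoC_mult; fold r; f_equal; ring. }
  replace (r * ((z + r) * (z + r)) / ((z + r) * (Cconj z + r)))%C
    with (r * (z + r) / (Cconj z + r))%C by (field; split; assumption).
  replace (r * (z + r))%C with (r * z + r * r)%C by ring.
  rewrite <- Z; field; exact Nz.
Qed.

(** The fixed point equation is quadratic, and the product of its roots is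
    -b / (conj(b) lam), of modulus 1: if neither root is in the disk, both are on the
    circle. *)
Lemma mobius_boundary_fixed_point (b lam : C) : Cmod b < 1 -> Cmod lam = 1 -> b <> 0%C ->
  (forall z : C, Cmod z < 1 -> (lam * z + b)%C <> (z * (1 + Cconj b * lam * z))%C) ->
  exists alpha : C, Cmod alpha = 1 /\
    (lam * alpha + b = alpha * (1 + Cconj b * lam * alpha))%C.
Proof.
intros Hb Hlam Nb Nf.
assert (NA : (Cconj b * lam)%C <> 0%C).
{ apply Cmod_gt_0; rewrite Cmod_mult, Cmod_conj, Hlam, Rmult_1_r; now apply Cmod_gt_0. }
set (A := (Cconj b * lam)%C) in *.
destruct (Csqrt_exists ((1 - lam) * (1 - lam) + 4 * A * b)%C) as [s Hs].
set (z1 := ((- (1 - lam) + s) / (2 * A))%C).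
set (z2 := ((- (1 - lam) - s) / (2 * A))%C).
assert (Root : forall x : C, (x * x = (1 - lam) * (1 - lam) + 4 * A * b)%C ->
  let z := ((- (1 - lam) + x) / (2 * A))%C in (lam * z + b = z * (1 + A * z))%C).
{ intros x Hx z.
  assert (Eb : (b = (x * x - (1 - lam) * (1 - lam)) / (4 * A))%C).
  { rewrite Hx; field; exact NA. }
  rewrite Eb at 1; unfold z; field; exact NA. }
assert (R1 : (lam * z1 + b = z1 * (1 + A * z1))%C) by exact (Root s Hs).
assert (R2 : (lam * z2 + b = z2 * (1 + A * z2))%C).
{ apply (Root (- s)%C); rewrite <- Hs; ring. }
assert (Pr : Cmod z1 * Cmod z2 = 1).
{ rewrite <- Cmod_mult.
  replace (z1 * z2)%C with (- (b / A))%C.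
    rewrite Cmod_opp, Cmod_div by exact NA.
    unfold A; rewrite Cmod_mult, Cmod_conj, Hlam; field.
    apply Cmod_gt_0 in Nb; lra.
  replace (z1 * z2)%C with (((1 - lam) * (1 - lam) - s * s) / (4 * A * A))%C
    by (unfold z1, z2; field; exact NA).
  rewrite Hs; field; exact NA. }
assert (L1 : 1 <= Cmod z1).
{ apply Rnot_lt_le; intros L; exact (Nf z1 L R1). }
assert (L2 : 1 <= Cmod z2).
{ apply Rnot_lt_le; intros L; exact (Nf z2 L R2). }
exists z1; split; [|exact R1].
assert (Cmod z1 * 1 <= Cmod z1 * Cmod z2) by (apply Rmult_le_compat_l; lra).
lra.
Qed.

(** The coordinate 1 / (z - alpha) sends the disk to a half-plane and the boundary fixed
    point alpha to infinity, so in it the map is affine.  That its linear coefficient is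
    a positive real number is what later excludes rotations of this coordinate. *)
Lemma mobius_linearization (b lam alpha z : C) :
  Cmod b < 1 -> Cmod lam = 1 -> Cmod alpha = 1 -> Cmod z < 1 ->
  (lam * alpha + b = alpha * (1 + Cconj b * lam * alpha))%C ->
  (/ ((lam * z + b) / (1 + Cconj b * lam * z) - alpha)
   = RtoC (Cmod (1 + Cconj b * lam * alpha)%C ^ 2 / (1 - Cmod b ^ 2)) * / (z - alpha)
     + Cconj b / (1 - alpha * Cconj b))%C.
Proof.
intros Hb Hlam Halpha Hz Fix.
assert (L := unimodular_conj lam Hlam); assert (La := unimodular_conj alpha Halpha).
set (e := (1 + Cconj b * lam * alpha)%C) in *.
set (n := (1 - alpha * Cconj b)%C) in *.
assert (Ne : e <> 0%C) by (apply mobius_denom_neq_0; lra).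
assert (Pb := Cmod_sqr_lt_1 _ Hb).
assert (NPb : RtoC (1 - Cmod b ^ 2) <> 0%C).
{ intros E; apply RtoC_inj in E; lra. }
assert (EN : (n * e = RtoC (1 - Cmod b ^ 2))%C).
{ rewrite RtoC_minus, Cmod2_conj.
  replace (n * e)%C with (e - Cconj b * (alpha * e))%C by (unfold n; ring).
  rewrite <- Fix; unfold e; ring. }
assert (Nn : n <> 0%C).
{ intros E; rewrite E, Cmult_0_l in EN; now symmetry in EN. }
assert (Ce : (lam * Cconj e = e)%C).
{ assert (E1 : (Cconj e = Cconj lam * Cconj alpha * (lam * alpha + b))%C).
  { unfold e; rewrite Cplus_conj, !Cmult_conj, Cconj_conj.
    replace (Cconj 1) with (RtoC 1) by (unfold Cconj, RtoC; simpl; now rewrite Ropp_0).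
    transitivity ((lam * Cconj lam) * (alpha * Cconj alpha)
      + b * Cconj lam * Cconj alpha)%C; [rewrite L, La|]; ring. }
  rewrite E1, Fix.
  transitivity ((lam * Cconj lam) * (alpha * Cconj alpha) * e)%C; [|rewrite L, La]; ring. }
assert (Ep : RtoC (Cmod e ^ 2 / (1 - Cmod b ^ 2)) = (e / (lam * n))%C).
{ assert (Nl : lam <> 0%C) by (apply Cmod_gt_0; lra).
  rewrite RtoC_div, Cmod2_conj, <- EN by lra.
  transitivity (Cconj e / n)%C; [field; split; assumption|].
  transitivity (lam * Cconj e / (lam * n))%C; [field; split; assumption|].
  now rewrite Ce. }
rewrite Ep.
assert (Nl : lam <> 0%C) by (apply Cmod_gt_0; lra).
assert (Nd := mobius_denom_neq_0 b lam z Hb Hlam (Rlt_le _ _ Hz)).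
assert (Nz : (z - alpha)%C <> 0%C).
{ intros E; apply Cminus_eq_0 in E; rewrite E in Hz; lra. }
replace ((lam * z + b) / (1 + Cconj b * lam * z) - alpha)%C
  with (lam * (z - alpha) * n / (1 + Cconj b * lam * z))%C.
- unfold e; field_simplify_eq; [ring | repeat split; assumption].
- replace b with (alpha * e - lam * alpha)%C at 2 by (rewrite <- Fix; ring).
  unfold n, e; field; exact Nd.
Qed.

(** In the coordinate sigma = 1 / (z - alpha) the map reads s |-> p s + q with p > 0 and
    q <> 0.  The n-th iterate multiplies differences by p^n, so returning times force
    p^(k n) to tend to 1 and p = 1.  Then the n-th iterate is the translation by n q,
    which moves every point at least by |q| when n >= 1. *)
Lemma mobius_without_fixed_point_not_returning
  (phi : disk -> disk) (b lam : C) (k : nat -> nat) :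
  Cmod b < 1 -> Cmod lam = 1 ->
  (forall z : disk, disk_val (phi z) = ((lam * z + b) / (1 + Cconj b * lam * z))%C) ->
  (forall z : disk, phi z <> z) -> ~ returning phi k.
Proof.
intros Hb Hlam Hphi Nfix Hk.
assert (Nf : forall z : C, Cmod z < 1 ->
  (lam * z + b)%C <> (z * (1 + Cconj b * lam * z))%C).
{ intros z Hz E; apply (Nfix (exist _ z Hz)), disk_eq; rewrite Hphi; simpl; rewrite E.
  field; apply mobius_denom_neq_0; lra. }
assert (Nb : b <> 0%C).
{ intros E; apply (Nf 0%C); [rewrite Cmod_0; lra | rewrite E; ring]. }
destruct (mobius_boundary_fixed_point b lam Hb Hlam Nb Nf) as [alpha [Ha Fix]].
set (p := Cmod (1 + Cconj b * lam * alpha)%C ^ 2 / (1 - Cmod b ^ 2)).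
set (q := (Cconj b / (1 - alpha * Cconj b))%C).
assert (Pp : 0 < p).
{ apply Rdiv_lt_0_compat; [apply pow_lt, Cmod_gt_0, mobius_denom_neq_0; lra|].
  now apply Cmod_sqr_lt_1. }
assert (Nq : 0 < Cmod q).
{ assert (B : Cmod (Cconj b) < 1) by now rewrite Cmod_conj.
  assert (N : (1 - alpha * Cconj b)%C <> 0%C).
  { intros E; apply Cminus_eq_0 in E; apply (f_equal Cmod) in E.
    rewrite Cmod_mult, Ha, Cmod_1 in E; lra. }
  unfold q; rewrite Cmod_div by exact N.
  apply Rdiv_lt_0_compat; [rewrite Cmod_conj|]; now apply Cmod_gt_0. }
set (sigma := fun z : C => (/ (z - alpha))%C).
assert (Lin : forall z : disk, sigma (phi z) = (p * sigma z + q)%C).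
{ intros z; unfold sigma; rewrite Hphi.
  apply mobius_linearization; try assumption; exact (proj2_sig z). }
assert (Na : forall z : disk, (z - alpha)%C <> 0%C).
{ intros z E; apply Cminus_eq_0 in E.
  assert (Hz := proj2_sig z : Cmod z < 1); rewrite E in Hz; lra. }
assert (Na' : forall z : disk, 0 < Cmod (z - alpha)%C).
{ intros z; apply Cmod_gt_0, Na. }
assert (Sd : forall z w : disk, Cmod (sigma z - sigma w)%C
  = Cmod (z - w)%C / (Cmod (z - alpha)%C * Cmod (w - alpha)%C)).
{ intros z w; unfold sigma.
  replace (/ (z - alpha) - / (w - alpha))%C
    with (- ((z - w) / ((z - alpha) * (w - alpha))))%C by (field; split; apply Na).
  rewrite Cmod_opp, Cmod_div, Cmod_mult; [reflexivity|].
  apply Cmult_neq_0; apply Na. }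
assert (Iter : forall n (z w : disk),
  Cmod (sigma (Nat.iter n phi z) - sigma (Nat.iter n phi w))%C
  = p ^ n * Cmod (sigma z - sigma w)%C).
{ intros n z w; induction n as [|n IH]; [simpl; ring|].
  change (Nat.iter (S n) phi z) with (phi (Nat.iter n phi z)).
  change (Nat.iter (S n) phi w) with (phi (Nat.iter n phi w)).
  rewrite !Lin.
  match goal with |- Cmod ?x = _ =>
    replace x with (p * (sigma (Nat.iter n phi z) - sigma (Nat.iter n phi w)))%C by ring
  end.
  rewrite Cmod_mult, IH, Cmod_R, Rabs_pos_eq by lra; simpl; ring. }
(* any two distinct points would do *)
assert (Hh : Cmod (/ 2)%C < 1).
{ rewrite <- RtoC_inv, Cmod_R, Rabs_pos_eq; lra. }
set (w := exist (fun x : C => Cmod x < 1) _ Hh : disk).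
set (D := Cmod (sigma disk0 - sigma w)%C).
assert (PD : 0 < D).
{ unfold D; rewrite Sd; apply Rdiv_lt_0_compat; [|now apply Rmult_lt_0_compat].
  apply Cmod_gt_0; simpl; intros E; apply Cminus_eq_0 in E.
  rewrite <- RtoC_inv in E by lra; apply RtoC_inj in E; lra. }
assert (Lp : is_lim_seq (fun n => p ^ k n) 1).
{ apply is_lim_seq_ext with
    (fun n => Cmod (sigma (Nat.iter (k n) phi disk0) - sigma (Nat.iter (k n) phi w))%C / D).
    intros n; rewrite Iter; fold D; field; lra.
  replace 1 with (D / D) by (field; lra).
  apply is_lim_seq_div'; [|apply is_lim_seq_const | lra].
  unfold D; rewrite Sd.
  apply is_lim_seq_ext with (fun n =>
    Cmod (Nat.iter (k n) phi disk0 - Nat.iter (k n) phi w)%C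
    / (Cmod (Nat.iter (k n) phi disk0 - alpha)%C * Cmod (Nat.iter (k n) phi w - alpha)%C)).
    intros n; now rewrite Sd.
  apply is_lim_seq_div'.
  - now apply returning_dist.
  - now apply is_lim_seq_mult'; apply returning_dist_const.
  - apply Rgt_not_eq; now apply Rmult_lt_0_compat. }
assert (P1 : p = 1).
{ apply Rle_antisym.
  - apply Rnot_lt_le; intros L.
    assert (p <= 1); [|lra].
    apply (is_lim_seq_le (fun _ => p) (fun n => p ^ k n) p 1); [|apply is_lim_seq_const|exact Lp].
    intros n; rewrite <- (pow_1 p) at 1; apply Rle_pow; [lra | exact (proj1 Hk n)].
  - apply Rnot_lt_le; intros L.
    assert (1 <= p); [|lra].
    apply (is_lim_seq_le (fun n => p ^ k n) (fun _ => p) 1 p); [|exact Lp|apply is_lim_seq_const].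
    intros n; destruct (k n) as [|m] eqn:E; [generalize (proj1 Hk n); lia|].
    rewrite <- (Rmult_1_r p) at 2; simpl; apply Rmult_le_compat_l; [lra|].
    rewrite <- (pow1 m); apply pow_incr; lra. }
assert (Trans : forall n, sigma (Nat.iter n phi disk0) = (sigma disk0 + INR n * q)%C).
{ intros n; induction n as [|n IH]; [simpl Nat.iter; simpl INR; ring|].
  change (Nat.iter (S n) phi disk0) with (phi (Nat.iter n phi disk0)).
  rewrite Lin, IH, P1, S_INR, RtoC_plus; ring. }
assert (Lq : is_lim_seq (fun n => INR (k n) * Cmod q) 0).
{ set (d := Cmod (disk0 - alpha)%C).
  apply is_lim_seq_ext with (fun n => Cmod (Nat.iter (k n) phi disk0 - disk0)%C
    / (Cmod (Nat.iter (k n) phi disk0 - alpha)%C * d)).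
  - intros n; unfold d; rewrite <- Sd, Trans.
    replace (sigma disk0 + INR (k n) * q - sigma disk0)%C with (INR (k n) * q)%C by ring.
    rewrite Cmod_mult, Cmod_R, Rabs_pos_eq; [reflexivity | apply pos_INR].
  - replace 0 with (0 / (d * d)) by (field; generalize (Na' disk0); unfold d; lra).
    apply is_lim_seq_div'.
    + exact (proj2 Hk disk0).
    + apply is_lim_seq_mult'; [now apply returning_dist_const | apply is_lim_seq_const].
    + apply Rgt_not_eq, Rmult_lt_0_compat; apply Na'. }
assert (Cmod q <= 0); [|lra].
apply (is_lim_seq_le (fun _ => Cmod q) (fun n => INR (k n) * Cmod q) (Cmod q) 0);
  [|apply is_lim_seq_const | exact Lq].
intros n; rewrite <- (Rmult_1_l (Cmod q)) at 1; apply Rmult_le_compat_r; [lra|].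
apply (le_INR 1); exact (proj1 Hk n).
Qed.

(** * Non-recurrence of composition operators *)

Theorem theorem5p19 (A : function_space) (hA : A = disk_algebra \/ A = H_infty)
  (phi : disk -> disk) (phi_analytic : analytic (fun z => phi z))
  (phi_nonconstant : ~ exists c : disk, forall z : disk, phi z = c)
  (phi_induces : induces_composition A phi)
  (phi_not_elliptic : ~ elliptic_automorphism phi) :
  ~ recurrent (composition_operator A phi phi_induces).
Proof.
intros Hrec.
destruct (returning_exists phi
  (recurrent_iterates_near_id A phi phi_induces (identity_mem A hA) Hrec)) as [k Hk].
destruct (pdist2_isometry_is_mobius phi phi_analytic
  (returning_pdist2_eq phi k phi_analytic Hk)) as [b [lam [Hb [Hlam Hphi]]]].
refine (mobius_without_fixed_point_not_returning phi b lam k Hb Hlam Hphi _ Hk).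
intros z Hz; apply phi_not_elliptic; split; [|now exists z].
exact (mobius_conformal_automorphism phi b lam Hb Hlam Hphi phi_analytic).
Qed.
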